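(* (a) (Type I model.) Let $\mu$ be a probability measure on $\mathcal{X}_0$ with $\mu^{\mathbb{Z}}(\mathcal{X}^* )=1$. Then $\mathcal{T}\mu^{\mathbb{Z}}=\mu^{\mathbb{Z}}$ if and only if there exists a probability measure $\nu$ on $\mathcal{U}_0$ such that $F(\mu\times\nu)=\mu\times\nu$. Moreover, when this holds, $\nu$ is the distribution of $U_n(x)$ for each $n\in\mathbb{Z}$, where $x$ is distributed according to $\mu^{\mathbb{Z}}$. (b) (Type II model.) Let $\mu,\tilde\mu$ be probability measures on $\mathcal{X}_0,\tilde{\mathcal{X}}_0$ respectively with $(\mu\times\tilde\mu)^{\mathbb{Z}}(\mathcal{X}^* )=1$. Then $\mathcal{T}(\mu\times\tilde\mu)^{\mathbb{Z}}=(\mu\times\tilde\mu)^{\mathbb{Z}}$ if and only if there exist probability measures $\nu,\tilde\nu$ on $\mathcal{U}_0,\tilde{\mathcal{U}}_0$ respectively such that $F_*(\mu\times\nu)=\tilde\mu\times\tilde\nu$. Moreover, when this holds, $\nu$ and $\tilde\nu$ are the distributions of $U_{2n-1}(x)$ and $U_{2n}(x)$ respectively, for each $n\in\mathbb{Z}$, where $x$ is distributed according to $(\mu\times\tilde\mu)^{\mathbb{Z}}$.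
   Context: Type I model: $\mathcal{X}_0,\mathcal{U}_0$ are Polish spaces and $F:\mathcal{X}_0\times\mathcal{U}_0\to\mathcal{X}_0\times\mathcal{U}_0$ is an involution; set $F_n^t:=F$ for all $n,t\in\mathbb{Z}$, and configurations are elements $x=(x_n)_{n\in\mathbb{Z}}\in\mathcal{X}_0^{\mathbb{Z}}$. Type II model: $\mathcal{X}_0,\tilde{\mathcal{X}}_0,\mathcal{U}_0,\tilde{\mathcal{U}}_0$ are Polish spaces and $F_*:\mathcal{X}_0\times\mathcal{U}_0\to\tilde{\mathcal{X}}_0\times\tilde{\mathcal{U}}_0$ is a bijection; set $F_n^t:=F_*$ if $n+t$ is even and $F_n^t:=F_*^{-1}$ if $n+t$ is odd; lattice variables satisfy $x_n^t\in\mathcal{X}_0$, $u_n^t\in\tilde{\mathcal{U}}_0$ if $n+t$ is even and $x_n^t\in\tilde{\mathcal{X}}_0$, $u_n^t\in\mathcal{U}_0$ if $n+t$ is odd; configurations are $x=(x_n)_{n\in\mathbb{Z}}$ with $x_n\in\mathcal{X}_0$ for $n$ even and $x_n\in\tilde{\mathcal{X}}_0$ for $n$ odd, and $(\mu\times\tilde\mu)^{\mathbb{Z}}$ denotes the product law under which $x_n\sim\mu$ for even $n$ and $x_n\sim\tilde\mu$ for odd $n$, all independent. In either case, $\mathcal{X}^*$ is the set of configurations $x$ for which there is a unique family $(x_n^t,u_n^t)_{n,t\in\mathbb{Z}}$ with $F_n^t(x_n^t,u_{n-1}^t)=(x_n^{t+1},u_n^t)$ for all $n,t\in\mathbb{Z}$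 and $x_n^0=x_n$ for all $n$. For $x\in\mathcal{X}^*$, $U_n(x):=u_n^0$, and the one-step dynamics is $\mathcal{T}(x)_n:=x_n^1$ for a type I model and $\mathcal{T}(x)_n:=x_{n+1}^1$ for a type II model. For a measurable map $G$ and a measure $m$, $G(m):=m\circ G^{-1}$ denotes the pushforward. *)

(* Defs.v *)
From HB Require Import structures.
From mathcomp Require Import all_boot all_order all_algebra.
From mathcomp Require Import all_classical all_reals all_analysis.
Set Implicit Arguments. Unset Strict Implicit. Unset Printing Implicit Defensive.
Import Order.TTheory GRing.Theory Num.Theory.
Local Open Scope classical_set_scope.
Local Open Scope ring_scope.

Section Polish.
Context {R : realType} {d : measure_display} (T : measurableType d).

Definition is_metric (dist : T -> T -> R) : Prop :=
  [/\ forall x y, 0 <= dist x y,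
      forall x y, dist x y = 0 <-> x = y,
      forall x y, dist x y = dist y x &
      forall x y z, dist x z <= dist x y + dist y z].

Definition metric_open (dist : T -> T -> R) (O : set T) : Prop :=
  forall x, O x -> exists2 e : R, 0 < e & forall y, dist x y < e -> O y.

Definition metric_complete (dist : T -> T -> R) : Prop :=
  forall u : nat -> T,
    (forall e : R, 0 < e -> exists N, forall m n, (N <= m)%N -> (N <= n)%N ->
        dist (u m) (u n) < e) ->
    exists l, forall e : R, 0 < e -> exists N, forall n, (N <= n)%N -> dist (u n) l < e.

Definition metric_separable (dist : T -> T -> R) : Prop :=
  exists D : set T, countable D /\
    forall x (e : R), 0 < e -> exists2 y, D y & dist x y < e.

Definition polish_borel : Prop :=
  exists dist : T -> T -> R,
    [/\ is_metric dist, metric_complete dist, metric_separable dist &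
        forall A : set T, measurable A <-> <<s metric_open dist >> A].
End Polish.

Definition cylinders {d} (X : measurableType d) : set (set (int -> X)) :=
  [set C | exists (n : int) (A : set X), measurable A /\ C = [set x | A (x n)]].

Definition config {d} (X : measurableType d) := g_sigma_algebraType (@cylinders _ X).

(* P is the product measure m^Z: its finite-dimensional marginals are
   products of m (this characterizes m^Z uniquely on the product
   sigma-algebra). *)
Definition is_iid_product {R : realType} {d} {X : measurableType d}
    (P : set (config X) -> \bar R) (m : set X -> \bar R) : Prop :=
  forall (s : seq int) (A : int -> set X), uniq s ->
    (forall n, measurable (A n)) ->
    P [set x : config X | forall n, n \in s -> A n (x n)] =
    (\big[*%E/1%E]_(n <- s) m (A n))%E.

(* Law statements in the completion of P.  [has_law P S q] : the set S
   is P-completion-measurable with completed measure q. *)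
Definition has_law {R : realType} {d} {T : measurableType d}
    (P : set T -> \bar R) (S : set T) (q : \bar R) : Prop :=
  exists2 B : set T, measurable B &
    P.-negligible ((S `\` B) `|` (B `\` S)) /\ P B = q.

Section TypeI.
Context {dX dU : measure_display} {X0 : measurableType dX} {U0 : measurableType dU}.
Variable F : X0 * U0 -> X0 * U0.

Definition solI (x : int -> X0) (xs : int -> int -> X0) (us : int -> int -> U0) :=
  (forall n t : int, F (xs n t, us (n - 1) t) = (xs n (t + 1), us n t)) /\
  (forall n : int, xs n 0 = x n).

Definition XstarI : set (config X0) :=
  [set x | exists xs us, solI x xs us /\
     forall xs' us', solI x xs' us' -> xs' = xs /\ us' = us].

Definition T_preI (A : set (config X0)) : set (config X0) :=
  [set x | XstarI x /\ exists xs us, solI x xs us /\ A (fun n => xs n 1)].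

Definition U_preI (n : int) (B : set U0) : set (config X0) :=
  [set x | XstarI x /\ exists xs us, solI x xs us /\ B (us n 0)].
End TypeI.

(* Type II model.  A configuration x with x_n in X0 (n even) and in    *)
(* Xt0 (n odd) is encoded as y : int -> X0 * Xt0, y k = (x_{2k}, x_{2k+1}),*)
(* so that (mu x mut)^Z is the i.i.d. product of mu \x mut.            *)
(* Lattice variables are encoded by four families, each meaningful     *)
(* only on the sites of the right parity of n+t:                        *)
(*   xE n t = x_n^t in X0, uE n t = u_n^t in Ut0   (n+t even)           *)
(*   xO n t = x_n^t in Xt0, uO n t = u_n^t in U0   (n+t odd)            *)
Section TypeII.
Context {dX dXt dU dUt : measure_display}
  {X0 : measurableType dX} {Xt0 : measurableType dXt}
  {U0 : measurableType dU} {Ut0 : measurableType dUt}.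
Variables (F : X0 * U0 -> Xt0 * Ut0) (Finv : Xt0 * Ut0 -> X0 * U0).

Definition evenz (z : int) : bool := (2 %| z)%Z.

Definition solII (y : int -> X0 * Xt0)
    (xE : int -> int -> X0) (xO : int -> int -> Xt0)
    (uE : int -> int -> Ut0) (uO : int -> int -> U0) : Prop :=
  [/\
      forall n t : int, evenz (n + t) ->
        F (xE n t, uO (n - 1) t) = (xO n (t + 1), uE n t),
      forall n t : int, ~~ evenz (n + t) ->
        Finv (xO n t, uE (n - 1) t) = (xE n (t + 1), uO n t) &
      forall k : int, xE (2 * k) 0 = (y k).1 /\ xO (2 * k + 1) 0 = (y k).2].

Definition XstarII : set (config (X0 * Xt0)%type) :=
  [set y | (exists xE xO uE uO, solII y xE xO uE uO) /\
     forall xE xO uE uO xE' xO' uE' uO',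
       solII y xE xO uE uO -> solII y xE' xO' uE' uO' ->
       forall n t : int,
         (evenz (n + t) -> xE n t = xE' n t /\ uE n t = uE' n t) /\
         (~~ evenz (n + t) -> xO n t = xO' n t /\ uO n t = uO' n t)].

(* T(x)_n = x_{n+1}^1; in the pair encoding
   T(y)_k = (x_{2k+1}^1, x_{2k+2}^1). *)
Definition T_preII (A : set (config (X0 * Xt0)%type)) : set (config (X0 * Xt0)%type) :=
  [set y | XstarII y /\ exists xE xO uE uO, solII y xE xO uE uO /\
     A (fun k => (xE (2 * k + 1) 1, xO (2 * k + 2) 1))].

Definition U_odd_preII (n : int) (B : set U0) : set (config (X0 * Xt0)%type) :=
  [set y | XstarII y /\ exists xE xO uE uO, solII y xE xO uE uO /\
     B (uO (2 * n - 1) 0)].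

Definition U_even_preII (n : int) (B : set Ut0) : set (config (X0 * Xt0)%type) :=
  [set y | XstarII y /\ exists xE xO uE uO, solII y xE xO uE uO /\
     B (uE (2 * n) 0)].
End TypeII.

(* Main.v *)
(* The lattice equations can be solved in both directions from the variables
   w = (x_k^{-k}, u_{k-1}^{-k})_k on the diagonal n + t = 0, so solutions
   correspond to such sequences w, and X* consists of the configurations with
   exactly one preimage under the map "row" sending w to (x_n^0)_n. By Luzin's
   separation theorem F^{-1} is Borel and row has a Borel inverse on a Borel
   subset of X* of full measure; hence the carriers are measurable.

   If F(mu x nu) = mu' x nu', start from independent mu x nu variables on the
   diagonal (an infinite product measure). Every diagonal is then again
   independent, row is distributed as the given product law, and translating the
   lattice preserves the law of the diagonal; this gives the invariance and the
   law of the carriers.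

   Conversely, uniqueness of solutions makes the carrier entering site 0 a
   function of the configuration away from site 0: otherwise the left half of one
   solution could be glued to the right half of another. So (x_0, U_{-1}) has a
   product law mu x nu. By the same argument in reversed time, (x_0^1, U_0) has
   independent components, and invariance identifies the law of x_0^1. As
   (x_0^1, U_0) = F(x_0, U_{-1}), the balance equation follows. *)

Require Import Defs.
From HB Require Import structures.
From mathcomp Require Import all_boot all_order all_algebra.
From mathcomp Require Import all_classical all_reals all_analysis.
From mathcomp Require Import measurable_realfun.
From mathcomp Require Import zify lra.
Import Order.TTheory GRing.Theory Num.Theory.
Local Open Scope classical_set_scope.
Local Open Scope ring_scope.
Set Implicit Arguments. Unset Strict Implicit. Unset Printing Implicit Defensive.

(** * Laws on configurations *)

(** Diagonals are preferred to rows because the sites on one diagonal have disjoint inputs: the next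
    diagonal arises by applying [F] to each pair separately and regrouping the outputs, with no
    carrier to be followed from minus infinity. Maps between diagonals, and [row] itself, are
    therefore visibly measurable; only the passage back from a configuration to its diagonal is
    delicate. As neither X* nor the carriers are known to be Borel, laws are stated up to null sets.
    Since [F] and [Finv] alternate, the map that can be iterated is a double step. Gluing shows that
    a carrier is insensitive to a coordinate only when solutions are unique both before and after
    the change; independence is then obtained by resampling that coordinate, which keeps the law. A
    type I model is read as a type II model with [Finv] equal to [F] by pairing neighbouring sites.
    This yields two carrier laws, for even and odd sites, which translation by one site then
    identifies. *)

Section Laws.
Context {R : realType}.

Lemma measurable_preimT d1 d2 (T1 : measurableType d1) (T2 : measurableType d2)
    (f : T1 -> T2) (A : set T2) :
  measurable_fun setT f -> measurable A -> measurable (f @^-1` A).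
Proof. by move=> mf mA; rewrite -[_ @^-1` _]setTI; exact: mf. Qed.

Definition image_law d1 d2 (T1 : measurableType d1) (T2 : measurableType d2)
    (P : probability T1 R) (f : T1 -> T2) (mf : measurable_fun setT f) :
    probability T2 R :=
  distribution P (mfun_Sub (mem_set mf)).

Lemma image_lawE d1 d2 (T1 : measurableType d1) (T2 : measurableType d2)
    (P : probability T1 R) (f : T1 -> T2) (mf : measurable_fun setT f) A :
  image_law P mf A = P (f @^-1` A).
Proof. by []. Qed.

Lemma full_measureI d1 (T1 : measurableType d1) (P : probability T1 R) (C N : set T1) :
  measurable C -> measurable N -> P N = 1%E -> P (C `&` N) = P C.
Proof.
move=> mC mN PN.
have -> : P C = (P (C `&` N) + P (C `&` ~` N))%E.
  rewrite -measureU ?setIUr ?setUv ?setIT//.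
  - by rewrite -setIUr setUv setIT.
  - exact: measurableI.
  - by apply: measurableI => //; exact: measurableC.
  - by rewrite setIACA setICr setI0.
have PNC : P (~` N) = 0%E by rewrite probability_setC// PN subee.
rewrite (_ : P (C `&` ~` N) = 0%E) ?adde0//.
apply: (subset_measure0 (B := ~` N)) => //.
- by apply: measurableI => //; exact: measurableC.
- exact: measurableC.
Qed.

Section ProductLaw.
Context d1 d2 (T1 : measurableType d1) (T2 : measurableType d2).
Variables (P1 : probability T1 R) (P2 : probability T2 R).

Let raw : set (T1 * T2) -> \bar R := (P1 \x P2)%E.

HB.instance Definition _ := Measure.on raw.

Let raw_setT : raw setT = 1%E.
Proof.
rewrite /raw -setXTT (product_measure1E _ _ measurableT measurableT).
by rewrite -[RHS]mule1; congr (_ * _)%E; exact: probability_setT.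
Qed.

HB.instance Definition _ := Measure_isProbability.Build _ _ _ raw raw_setT.

Definition product_law : probability (T1 * T2)%type R := raw.

Lemma product_lawX A B : measurable A -> measurable B ->
  product_law (A `*` B) = (P1 A * P2 B)%E.
Proof. exact: product_measure1E. Qed.

Lemma product_law_unique (P : probability (T1 * T2)%type R) :
  (forall A B, measurable A -> measurable B -> P (A `*` B) = P1 A * P2 B)%E ->
  forall C, measurable C -> product_law C = P C.
Proof. exact: product_measure_unique. Qed.

End ProductLaw.

End Laws.

Section Config.
Context {R : realType} {d : measure_display} {Z : measurableType d}.
Implicit Types (P : probability (config Z) R) (x y : config Z).

Lemma measurable_coord (n : int) : measurable_fun setT (fun x : config Z => x n).
Proof.
move=> _ A mA; rewrite setTI; apply: sub_sigma_algebra.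
by exists n, A.
Qed.

Lemma measurable_to_config d' (T : measurableType d') (f : T -> config Z) :
  (forall n, measurable_fun setT (fun t => f t n)) -> measurable_fun setT f.
Proof.
move=> mf; apply: (@measurability _ _ T (config Z) setT f (@cylinders _ Z) erefl).
by move=> _ [_ [n [A [mA ->]]] <-]; rewrite setTI; exact: measurable_preimT (mf n) mA.
Qed.

Definition window (K : nat) : seq int := [seq j%:Z - K%:Z | j <- iota 0 K.*2].

Lemma mem_window K (n : int) : (n \in window K) = (- K%:Z <= n < K%:Z).
Proof.
apply/mapP/idP => [[j]|nK]; first by rewrite mem_iota => ? ->; lia.
by exists (absz (n + K%:Z)); [rewrite mem_iota; lia|lia].
Qed.

Lemma uniq_window K : uniq (window K).
Proof. by rewrite map_inj_uniq ?iota_uniq// => i j; lia. Qed.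

Lemma leq_mem_window K K' n : (K <= K')%N -> n \in window K -> n \in window K'.
Proof. by move=> KK'; rewrite !mem_window; lia. Qed.

Lemma mem_window_abs (n : int) : n \in window `|n|.+1.
Proof. by rewrite mem_window; lia. Qed.

Lemma measurable_box (s : seq int) (A : int -> set Z) :
  (forall n, measurable (A n)) ->
  measurable [set x : config Z | forall n, n \in s -> A n (x n)].
Proof.
move=> mA; elim: s => [|n s ih].
  by rewrite [X in measurable X](_ : _ = setT)//; apply/seteqP; split.
rewrite [X in measurable X](_ : _ = [set x : config Z | A n (x n)] `&`
   [set x : config Z | forall n, n \in s -> A n (x n)]).
  by apply: measurableI => //; exact: measurable_preimT (measurable_coord n) (mA n).
apply/seteqP; split => x /=.
  by move=> h; split; [apply: h; rewrite inE eqxx|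
    move=> k ks; apply: h; rewrite inE ks orbT].
by move=> [h1 h2] k; rewrite inE => /orP[/eqP ->//|]; exact: h2.
Qed.

(** Boxes over the nested windows form a pi-system: two of them intersect in a box over the larger
    window, with sides padded by [setT]. A generating pi-system [G] for the sides is allowed because
    pairs are best tested on rectangles. *)
Lemma config_law_unique (G : set (set Z)) (P1 P2 : probability (config Z) R) :
  measurable = <<s G >> -> setI_closed G -> G setT ->
  (forall K (A : int -> set Z), (forall n, G (A n)) ->
    P1 [set x | forall n, n \in window K -> A n (x n)] =
    P2 [set x | forall n, n \in window K -> A n (x n)]) ->
  forall B, measurable B -> P1 B = P2 B.
Proof.
move=> mG GI GT P12 B mB.
pose H : set (set (config Z)) := [set C | exists K A, (forall n, G (A n)) /\
   C = [set x | forall n, n \in window K -> A n (x n)]].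
have Gm A : G A -> measurable A by rewrite mG; exact: sub_sigma_algebra.
have HT : H setT.
  by exists 0%N, (fun=> setT); split => //; apply/seteqP; split => // x _ n.
apply: (@g_sigma_algebra_measure_unique _ R _ H _ (fun=> setT) _ _ P1 P2) => //.
- by move=> _ [K [A [GA ->]]]; apply: measurable_box => n; exact: Gm.
- by rewrite bigcup_const.
- move=> _ _ [K [A [GA ->]]] [K' [A' [GA' ->]]].
  pose E (L : nat) (D : int -> set Z) n := if n \in window L then D n else setT.
  exists (maxn K K'), (fun n => E K A n `&` E K' A' n); split.
    by move=> n; apply: GI; rewrite /E; case: ifP.
  apply/seteqP; split => x /=.
    by move=> [h h'] n _; rewrite /E; split; case: ifP => // hn; [exact: h|exact: h'].
  move=> h; split => n hn.
    have [|+ _] := h n; first by apply: leq_mem_window hn; rewrite leq_maxl.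
    by rewrite /E hn.
  have [|_] := h n; first by apply: leq_mem_window hn; rewrite leq_maxr.
  by rewrite /E hn.
- by move=> _ [K [A [GA ->]]]; exact: P12.
- by move=> _ /=; rewrite probability_setT ltry.
move: B mB; apply: smallest_sub; first exact: smallest_sigma_algebra.
move=> _ [n [A [mA ->]]].
pose S : set (set Z) := [set A | <<s H >> [set x : config Z | A (x n)]].
suff : <<s G >> `<=` S by apply; rewrite -mG.
apply: smallest_sub.
  split; rewrite /S /=.
  - rewrite (_ : [set x | _] = set0); first exact: sigma_algebra0.
    by apply/seteqP; split.
  - move=> D hD.
    rewrite (_ : [set x | _] = ~` [set x : config Z | D (x n)]).
      exact: sigma_algebraC.
    by apply/seteqP; split => x; rewrite /setD /=; tauto.
  - move=> F hF; rewrite (_ : [set x | _] = \bigcup_i [set x : config Z | F i (x n)]).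
      exact: sigma_algebra_bigcup.
    by apply/seteqP; split.
move=> D GD; apply: sub_sigma_algebra.
exists `|n|.+1, (fun k => if k == n then D else setT); split.
  by move=> k; case: ifP.
apply/seteqP; split => x /=.
  by move=> h k _; case: eqP => // ->.
by move=> /(_ n (mem_window_abs n)); rewrite eqxx.
Qed.

Lemma iid_unique (m : set Z -> \bar R) P1 P2 :
  is_iid_product P1 m -> is_iid_product P2 m ->
  forall B, measurable B -> P1 B = P2 B.
Proof.
move=> h1 h2; apply: (@config_law_unique measurable).
- by apply/esym; exact: (@sigma_algebra_id _ setT _ (@sigma_algebra_measurable _ Z)).
- exact: measurableI.
- exact: measurableT.
- by move=> K A mA; rewrite h1 ?h2 ?uniq_window.
Qed.

Definition upd (n : int) (z : Z) (x : config Z) : config Z :=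
  fun k => if k == n then z else x k.

Lemma measurable_upd n :
  measurable_fun setT (fun p : config Z * Z => upd n p.2 p.1).
Proof.
apply: measurable_to_config => k; rewrite /upd; case: eqP => _.
  exact measurable_snd.
exact (measurableT_comp (measurable_coord k) measurable_fst).
Qed.

Lemma resample_law P (m : probability Z R) (n : int) :
  is_iid_product P m -> forall B, measurable B ->
  product_law P m [set p | B (upd n p.2 p.1)] = P B.
Proof.
move=> iidP B mB.
rewrite -[LHS](image_lawE (product_law P m) (measurable_upd n)).
apply: (@iid_unique m) => // s A us mA; rewrite image_lawE.
pose An := if n \in s then A n else setT.
rewrite (_ : _ @^-1` _ =
  [set x | forall k, k \in rem n s -> A k (x k)] `*` An); last first.
  apply/seteqP; split => -[x z] /=.
    move=> h; split.
      move=> k; rewrite mem_rem_uniq// inE => /andP[kn ks].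
      by have := h k ks; rewrite /upd (negbTE kn).
    by rewrite /An; case: ifP => // ns; have := h n ns; rewrite /upd eqxx.
  move=> [h1 h2] k ks; rewrite /upd; case: eqP => [kn|/eqP kn].
    by move: h2; rewrite /An -kn ks.
  by apply: h1; rewrite mem_rem_uniq// inE kn.
have mAn : measurable An by rewrite /An; case: ifP.
rewrite product_lawX//; last exact: measurable_box.
rewrite iidP ?rem_uniq// /An; case: ifP => ns.
  by rewrite (perm_big _ (perm_to_rem ns)) big_cons muleC.
by rewrite probability_setT mule1 rem_id ?ns.
Qed.

(* [B] need only be insensitive to the [n]-th coordinate on a set of full
   measure: resampling that coordinate does not change the law. *)
Lemma iid_indep P (m : probability Z R) (n : int) (N B : set (config Z)) (A : set Z) :
  is_iid_product P m -> measurable N -> P N = 1%E -> measurable B -> measurable A ->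
  (forall x z, N x -> N (upd n z x) -> B x <-> B (upd n z x)) ->
  P ([set x | A (x n)] `&` B) = (m A * P B)%E.
Proof.
move=> iidP mN PN mB mA BN.
have mcA : measurable [set x : config Z | A (x n)].
  exact: measurable_preimT (measurable_coord n) mA.
pose u (p : config Z * Z) := upd n p.2 p.1.
have mu_ C : measurable C -> measurable (u @^-1` C).
  exact: measurable_preimT (measurable_upd n).
have mfst C : measurable C -> measurable ([set p : config Z * Z | C p.1]).
  by move=> mC; exact: measurable_preimT (@measurable_fst _ _ _ _) mC.
have msnd C : measurable C -> measurable ([set p : config Z * Z | C p.2]).
  by move=> mC; exact: measurable_preimT (@measurable_snd _ _ _ _) mC.
have full1 C : measurable C ->
    product_law P m (C `&` [set p | N p.1]) = product_law P m C.
  move=> mC; apply: full_measureI => //; first exact: mfst.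
  rewrite (_ : [set p | _] = N `*` setT); last first.
    by apply/seteqP; split => -[x z] //= [].
  by rewrite product_lawX// PN probability_setT mule1.
have full2 C : measurable C ->
    product_law P m (C `&` u @^-1` N) = product_law P m C.
  move=> mC; apply: full_measureI => //; first exact: mu_.
  by rewrite [LHS](resample_law n iidP).
rewrite -(resample_law n iidP); last exact: measurableI.
rewrite -/(u @^-1` _) -full1; last by apply: mu_; exact: measurableI.
rewrite -full2; last by apply: measurableI; [apply: mu_; exact: measurableI|exact: mfst].
(* Within both full sets [A] sees only the fresh value and [B] may be read off the old
   configuration, so the event is a rectangle. *)
rewrite (_ : _ `&` _ = ([set p | B p.1 /\ A p.2] `&` [set p | N p.1]) `&` u @^-1` N).
  rewrite full2; last first.
    by apply: measurableI (mfst _ mN); apply: measurableI (mfst _ mB) (msnd _ mA).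
  rewrite full1; last by apply: measurableI (mfst _ mB) (msnd _ mA).
  by rewrite muleC -product_lawX.
apply/seteqP; split => -[x z] /= [[]]; rewrite /u /upd /= eqxx => -[h1 h2] Nx Nu.
  by split => //; split => //; split => //; apply/(BN x z).
by split => //; split => //; split => //; apply/(BN x z).
Qed.

Lemma shift_iid P (m : set Z -> \bar R) a : is_iid_product P m ->
  forall mf : measurable_fun setT (fun (x : config Z) => (fun n => x (n + a)) : config Z),
  is_iid_product (image_law P mf) m.
Proof.
move=> iidP mf s A us mA; rewrite image_lawE.
have inj : injective (fun n : int => n + a) by move=> i j; lia.
rewrite (_ : _ @^-1` _ = [set x | forall n, n \in [seq k + a | k <- s] -> A (n - a) (x n)]).
  by rewrite (iidP _ (fun n => A (n - a))) ?map_inj_uniq// big_map; under eq_bigr do rewrite addrK.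
apply/seteqP; split => x /= h n.
  by move=> /mapP[k ks ->]; rewrite addrK; exact: h.
move=> ns; have /h : n + a \in [seq k + a | k <- s] by apply/mapP; exists n.
by rewrite addrK.
Qed.

End Config.

(** * Existence of infinite product measures *)

Section IidExistence.
Local Open Scope ereal_scope.
Context {R : realType} {d : measure_display} {Z : measurableType d}.
Variable m : probability Z R.
Implicit Types (x y : config Z) (f g : config Z -> \bar R) (A B : set (config Z)).

(** Coordinates are numbered by [pickle], so that they can be treated one after another; a number
    that is not a code leaves [x] unchanged. *)
Let setk (k : nat) (z : Z) x : config Z := fun n => if pickle n == k then z else x n.

Let measurable_setk k : measurable_fun setT (fun p : config Z * Z => setk k p.2 p.1).
Proof.
apply: measurable_to_config => n; rewrite /setk; case: eqP => _.
  exact measurable_snd.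
exact (measurableT_comp (measurable_coord n) measurable_fst).
Qed.

Let measurable_setkr k x : measurable_fun setT (fun z : Z => setk k z x).
Proof.
by apply: measurable_to_config => n; rewrite /setk; case: eqP => _.
Qed.

Let integrate_coord (k : nat) f : config Z -> \bar R :=
  fun x => \int[m]_z f (setk k z x).

Let nnm f := (forall x, 0 <= f x) /\ measurable_fun setT f.

Let nnm_integrate k f : nnm f -> nnm (integrate_coord k f).
Proof.
move=> [f0 mf]; split => [x|]; first exact: integral_ge0.
exact: (@measurable_fun_fubini_tonelli_F _ _ _ _ _ m
  (fun p : config Z * Z => f (setk k p.2 p.1))
  (measurableT_comp mf (measurable_setk k)) (fun p => f0 _)).
Qed.

Let nnm_setk k x f : nnm f -> measurable_fun setT (fun z => f (setk k z x)).
Proof. by move=> [_ mf]; exact (measurableT_comp mf (measurable_setkr k x)). Qed.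

(** The outermost integral is over coordinate [k], the innermost over [k + j - 1]. When [f] depends
    on coordinates below [k + j], this is its conditional expectation given those below [k]. *)
Fixpoint integrate_coords (k j : nat) f : config Z -> \bar R :=
  if j is j'.+1 then integrate_coord k (integrate_coords k.+1 j' f) else f.
Local Notation J := integrate_coords.

Let nnm_J k j f : nnm f -> nnm (J k j f).
Proof. by elim: j k => [//|j ih] k hf /=; apply: nnm_integrate; exact: ih. Qed.

Let J_add k j f g x : nnm f -> nnm g ->
  J k j (fun x => f x + g x) x = J k j f x + J k j g x.
Proof.
move=> hf hg; elim: j k x => [//|j ih] k x /=.
rewrite /integrate_coord; under eq_integral do rewrite ih.
rewrite ge0_integralD//.
- by move=> z _; exact: (nnm_J _ _ hf).1.
- exact: nnm_setk (nnm_J _ _ hf).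
- by move=> z _; exact: (nnm_J _ _ hg).1.
- exact: nnm_setk (nnm_J _ _ hg).
Qed.

Let J_le k j f g x : nnm f -> nnm g -> (forall x, f x <= g x) ->
  J k j f x <= J k j g x.
Proof.
move=> hf hg fg; elim: j k x => [//|j ih] k x /=.
apply: ge0_le_integral => //.
- by move=> z _; exact: (nnm_J _ _ hf).1.
- exact: nnm_setk (nnm_J _ _ hf).
- exact: nnm_setk (nnm_J _ _ hg).
Qed.

Let integrate_cst k (f : config Z -> \bar R) x (c : \bar R) : (forall z, f (setk k z x) = c) ->
  integrate_coord k f x = c.
Proof.
move=> fc; rewrite /integrate_coord.
rewrite (eq_integral (cst c)); last by move=> z _; rewrite fc.
by rewrite integral_cst// -[RHS]mule1; congr (_ * _); exact: probability_setT.
Qed.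

Let J_cst k j (c : \bar R) x : J k j (cst c) x = c.
Proof.
by elim: j k x => [//|j ih] k x /=; apply: integrate_cst => z; exact: ih.
Qed.

Let agree (n : nat) x y := forall i : int, (pickle i < n)%N -> x i = y i.

Let dep n f := forall x y, agree n x y -> f x = f y.

Let agree_setk n k z x : (n <= k)%N -> agree n (setk k z x) x.
Proof. by move=> nk i hi; rewrite /setk; case: eqP => // e; lia. Qed.

Let J_dep n f k j x : dep n f -> (n <= k)%N -> J k j f x = f x.
Proof.
move=> df; elim: j k x => [//|j ih] k x nk /=; apply: integrate_cst => z.
by rewrite ih ?(leqW nk)//; apply: df; exact: agree_setk.
Qed.

Let J_stable n f k j i x : dep n f -> (n <= k + j)%N -> J k (j + i) f x = J k j f x.
Proof.
move=> df; elim: j k x => [|j ih] k x nk.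
  by rewrite add0n /= (J_dep _ _ df)//; lia.
by rewrite addSn /= /integrate_coord; apply: eq_integral => z _; apply: ih; lia.
Qed.

Let ind A : config Z -> \bar R := fun x => (\1_A x)%:E.

Let nnm_ind A : measurable A -> nnm (ind A).
Proof.
move=> mA; split => [x|]; first by rewrite lee_fin.
by apply/measurable_EFinP.
Qed.

Let indT A x : A x -> ind A x = 1.
Proof. by move=> Ax; rewrite /ind indicE mem_set. Qed.

Let indF A x : ~ A x -> ind A x = 0.
Proof. by move=> Ax; rewrite /ind indicE memNset. Qed.

Definition cylinder_set A :=
  measurable A /\ exists n, forall x y, agree n x y -> A x -> A y.

Let cyl_dep A : cylinder_set A -> exists n, dep n (ind A).
Proof.
move=> [_ [n hn]]; exists n => x y xy.
have yx : agree n y x by move=> i hi; rewrite xy.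
case: (pselect (A x)) => Ax; first by rewrite !indT//; exact: hn xy Ax.
by rewrite !indF// => Ay; apply: Ax; exact: hn yx Ay.
Qed.

Let cyl0 : cylinder_set set0.
Proof. by split => //; exists 0%N. Qed.

Let cylU : setU_closed cylinder_set.
Proof.
move=> A B [mA [n hA]] [mB [k hB]]; split; first exact: measurableU.
exists (maxn n k) => x y xy [Ax|Bx].
  by left; apply: hA Ax => i hi; apply: xy; rewrite leq_max hi.
by right; apply: hB Bx => i hi; apply: xy; rewrite leq_max hi orbT.
Qed.

Let cylC : setC_closed cylinder_set.
Proof.
move=> A [mA [n hA]]; split; first exact: measurableC.
by exists n => x y xy Ax Ay; apply: Ax; apply: hA Ay => i hi; rewrite xy.
Qed.

(** Any admissible bound, not necessarily the least one; [tail_probE] makes the choice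
    immaterial. *)
Let rank A := xget 0%N [set n | dep n (ind A)].

Let rankP A : cylinder_set A -> dep (rank A) (ind A).
Proof. by move=> /cyl_dep[n hn]; rewrite /rank; case: xgetP => // /(_ n). Qed.

(** The conditional probability of [A] given the coordinates of [x] numbered below [k]. Truncated
    subtraction makes it the indicator of [A] once [k] reaches the rank. *)
Let tail_prob (k : nat) A x := J k (rank A - k) (ind A) x.

Let tail_probE k j A x : cylinder_set A -> (rank A <= k + j)%N ->
  tail_prob k A x = J k j (ind A) x.
Proof.
move=> cA kj; rewrite /tail_prob.
have [h|h] := leqP (rank A - k) j.
  by rewrite -(subnKC h) (J_stable _ _ (rankP cA)) //; lia.
by rewrite -{1}(subnKC (ltnW h)) (J_stable _ _ (rankP cA)).
Qed.

Let tail_prob_step k A x : cylinder_set A ->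
  tail_prob k A x = \int[m]_z tail_prob k.+1 A (setk k z x).
Proof.
move=> cA; rewrite (@tail_probE k (rank A).+1)//; last lia.
rewrite /= /integrate_coord; apply: eq_integral => z _.
by rewrite (@tail_probE k.+1 (rank A))//; lia.
Qed.

Let tail_prob_end k A x : cylinder_set A -> (rank A <= k)%N -> tail_prob k A x = ind A x.
Proof. by move=> cA kA; rewrite (@tail_probE k 0) ?addn0. Qed.

Let tail_prob_nnm k A : cylinder_set A -> nnm (tail_prob k A).
Proof. by move=> cA; apply: nnm_J; apply: nnm_ind; case: cA. Qed.

Let tail_prob_le k A B x : cylinder_set A -> cylinder_set B -> A `<=` B ->
  tail_prob k A x <= tail_prob k B x.
Proof.
move=> cA cB AB.
rewrite (@tail_probE k (maxn (rank A) (rank B)))//; last lia.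
rewrite (@tail_probE k (maxn (rank A) (rank B)) B)//; last lia.
apply: J_le.
- by apply: nnm_ind; case: cA.
- by apply: nnm_ind; case: cB.
- move=> y; case: (pselect (A y)) => Ay; first by rewrite !indT//; exact: AB.
  by rewrite indF// lee_fin.
Qed.

Let tail_prob_le1 k A x : cylinder_set A -> tail_prob k A x <= 1.
Proof.
move=> cA; rewrite -(J_cst k (rank A - k) 1 x); apply: J_le.
- by apply: nnm_ind; case: cA.
- by split.
- by move=> y; rewrite lee_fin indicE; case: (_ \in _).
Qed.

(** The base point is immaterial: every coordinate on which [A] depends is integrated out. *)
Definition cylinder_prob A := tail_prob 0 A (fun=> point).
Local Notation lam := cylinder_prob.

Let lam0 : lam set0 = 0.
Proof.
rewrite /lam /tail_prob (_ : ind set0 = cst 0) ?J_cst//.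
by apply/funext => x; rewrite indF.
Qed.

Let lamU A B : cylinder_set A -> cylinder_set B -> A `&` B = set0 ->
  lam (A `|` B) = lam A + lam B.
Proof.
move=> cA cB AB0; have cAB := cylU cA cB.
pose n := maxn (rank (A `|` B)) (maxn (rank A) (rank B)).
rewrite /lam !(@tail_probE 0 n)//; try lia.
rewrite -J_add; [|by apply: nnm_ind; case: cA|by apply: nnm_ind; case: cB].
congr (J _ _ _ _); apply/funext => x.
case: (pselect (A x)) => Ax; case: (pselect (B x)) => Bx.
- by have : (A `&` B) x by []; rewrite AB0.
- by rewrite (indT Ax) (indF Bx) adde0 indT//; left.
- by rewrite (indF Ax) (indT Bx) add0e indT//; right.
- by rewrite !indF ?adde0// => -[].
Qed.

(* Ionescu-Tulcea: if the probabilities of decreasing cylinders stay above a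
   positive level, one can choose the coordinates of a common point one at a
   time, keeping all conditional probabilities above that level. *)
Let lam_cap (F : nat -> set (config Z)) (e : R) : (0 < e)%R ->
  (forall i, cylinder_set (F i)) ->
  (forall i j, (i <= j)%N -> F j `<=` F i) ->
  (forall i, e%:E <= lam (F i)) -> exists x, forall i, F i x.
Proof.
move=> e0 cF ndF eF.
(* Levels are only asked to stay strictly above [e / 2], so every step may lower the level a
   little. *)
pose e' : R := (e / 2)%R.
pose good k x := exists2 a : R, (e' < a)%R & forall i, a%:E <= tail_prob k (F i) x.
have step k x : good k x -> exists z, good k.+1 (setk k z x).
  move=> [a ea aF]; pose b := ((e' + a) / 2)%R.
  have [eb ba b0] : [/\ (e' < b)%R, (b < a)%R & (0 <= b)%R].
    by move: ea e0; rewrite /b /e'; split; lra.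
  clearbody b; apply/not_existsP => nz.
  have {}nz z : exists i, tail_prob k.+1 (F i) (setk k z x) < b%:E.
    apply/not_existsP => h; apply: (nz z); exists b => //.
    by move=> i; rewrite leNgt; apply/negP => /h.
  (* If no value [z] were good, these sets would decrease to the empty set. Then [m (C i)] would
     fall below [a - b], and the integral of the conditional probabilities, at most [b + m (C i)],
     below [a]. *)
  pose C i := [set z | b%:E <= tail_prob k.+1 (F i) (setk k z x)].
  have mC i : measurable (C i).
    rewrite -[C i]setTI.
    exact (emeasurable_fun_c_infty measurableT (nnm_setk k x (tail_prob_nnm _ (cF i))) _).
  have C0 : \bigcap_i C i = set0.
    apply/seteqP; split => // z hz; have [i] := nz z.
    by rewrite ltNge (hz i).
  have ndC : nonincreasing_seq C.
    move=> i j ij; apply/subsetPset => z; rewrite /C /= => /le_trans; apply.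
    by apply: tail_prob_le => //; exact: ndF.
  have : m (C i) @[i --> \oo] --> m (\bigcap_i C i).
    apply: nonincreasing_cvg_mu => //.
      by rewrite (le_lt_trans (probability_le1 _ _)) ?ltry.
    exact: bigcapT_measurable.
  rewrite C0 measure0 => mC0.
  have : \forall i \near \oo, m (C i) < (a - b)%:E.
    have ab : ereal_nbhs (0 : \bar R) (fun u => u < (a - b)%:E).
      by apply: open_ereal_lt'; rewrite lte_fin subr_gt0.
    exact (mC0 _ ab).
  move=> [i _ /(_ i (leqnn i))] /= mCi.
  have := aF i; rewrite tail_prob_step//.
  apply/negP; rewrite -ltNge.
  apply: (@le_lt_trans _ _ (\int[m]_z (cst b%:E z + (\1_(C i) z)%:E))).
    apply: ge0_le_integral => //.
    - by move=> z _; exact: (tail_prob_nnm _ (cF i)).1.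
    - exact: nnm_setk (tail_prob_nnm _ (cF i)).
    - apply: emeasurable_funD => //; exact/measurable_EFinP.
    - move=> z _; rewrite indicE; case: (boolP (z \in C i)) => hz.
        apply: (le_trans (tail_prob_le1 _ _ (cF i))); by rewrite leeDr//= lee_fin.
      rewrite adde0; move: hz; rewrite notin_setE /C /= => /negP.
      by rewrite -ltNge => /ltW.
  rewrite ge0_integralD//; last exact/measurable_EFinP.
  rewrite integral_cst// [X in _ * X](_ : _ = 1); last exact: probability_setT.
  rewrite mule1 integral_indic// setIT.
  by rewrite -lteBrDl// -EFinB.
have good0 : good 0%N (fun=> point).
  by exists e => //; move: e0; rewrite /e'; lra.
have [u [gu su]] : exists u : nat -> config Z,
   (forall k, good k (u k)) /\ forall k, exists z, u k.+1 = setk k z (u k).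
  have /choice[nx nxP] : forall p : nat * config Z, exists z,
      good p.1 p.2 -> good p.1.+1 (setk p.1 z p.2).
    move=> [k x]; case: (pselect (good k x)) => [/step[z hz]|h].
      by exists z.
    by exists point.
  pose u := fix u k := if k is k'.+1 then setk k' (nx (k', u k')) (u k') else (fun=> point).
  exists u; split; last by move=> k; exists (nx (k, u k)).
  by elim=> [//|k ih]; exact: (nxP (k, u k)).
have uE j k i : (pickle i < k)%N -> u (k + j)%N i = u k i.
  move=> ik; elim: j => [|j ih]; first by rewrite addn0.
  by rewrite addnS; have [z ->] := su (k + j)%N; rewrite (@agree_setk k)//; lia.
(* Coordinate [i] is chosen in passing to stage [(pickle i).+1] and kept from then on. *)
exists (fun i => u (pickle i).+1 i) => i.
have cFi := cF i.
have [n hn] : exists n, forall x y, agree n x y -> F i x -> F i y by case: cFi.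
pose k := maxn n (rank (F i)).
(* Past the rank the conditional probability is the indicator, and a positive value forces
   membership. *)
have Fu : F i (u k).
  have [a ea /(_ i)] := gu k; rewrite tail_prob_end//; last by rewrite /k; lia.
  apply: contra_leP => h; rewrite indF// lte_fin.
  by move: ea; rewrite /e'; lra.
apply: hn Fu => j hj.
have jk : (pickle j < k)%N by rewrite /k; lia.
by rewrite -(subnKC jk) uE.
Qed.


Let lam_ge0 A : 0 <= lam A.
Proof.
rewrite /lam /tail_prob.
have : forall j k x, 0 <= J k j (ind A) x; last exact.
elim=> [|j ih] k x /=; first by rewrite /ind lee_fin.
by apply: integral_ge0 => z _; exact: ih.
Qed.

(** An alias, so that the algebra of cylinders does not clash with the sigma-algebra already carried
    by [config Z]. *)
Definition cylinder_algebra := config Z.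

HB.instance Definition _ := Pointed.on cylinder_algebra.
HB.instance Definition _ := isAlgebraOfSets.Build (sigma_display cylinder_set)
  cylinder_algebra cyl0 cylU cylC.

Definition cylinder_content : set cylinder_algebra -> \bar R := cylinder_prob.

Let cylinder_content_additive : measure_function.semi_additive cylinder_content.
Proof.
have h : measure_function.additive2 cylinder_content by move=> A B cA cB; exact: lamU.
exact: (proj2 (measure_function.additive2P (mu := cylinder_content) lam0) h).
Qed.

HB.instance Definition _ := isContent.Build _ cylinder_algebra R cylinder_content
  lam_ge0 cylinder_content_additive.

(** The parts of [A] missed by the first [n] covering sets decrease to the empty set, so by
    [lam_cap] their content cannot stay above a positive [e]. *)
Let cylinder_content_sigma_subadditive :
  measurable_subset_sigma_subadditive cylinder_content.
Proof.
move=> A F cF cA AF.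
apply/lee_addgt0Pr => e e0.
pose D n := A `\` \big[setU/set0]_(i < n) F i.
have mU n : measurable (\big[setU/set0]_(i < n) F i : set cylinder_algebra).
  by apply: bigsetU_measurable => i _; exact: cF.
have mD n : measurable (D n : set cylinder_algebra) by apply: measurableD.
have [n De] : exists n, lam (D n) < e%:E.
  apply/not_existsP => h.
  have [||i j ij|i|x] := @lam_cap D e.
  - by [].
  - exact: mD.
  - move=> x [Ax nF]; split => // Fx; apply: nF.
    rewrite -bigcup_mkord in Fx; rewrite -bigcup_mkord.
    by case: Fx => l /= li Fl; exists l => //=; lia.
  - by rewrite leNgt; apply/negP; exact: h.
  move=> xD; have [Ax _] := xD 0%N.
  have [l _ Fl] := AF _ Ax; have [_ nFl] := xD l.+1; apply: nFl.
  by rewrite -bigcup_mkord; exists l => /=.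
have DA : A `<=` D n `|` \big[setU/set0]_(i < n) F i.
  by move=> x Ax; case: (pselect ((\big[setU/set0]_(i < n) F i) x)); [right|left].
apply: (@le_trans _ _ (cylinder_content (D n) +
    cylinder_content (\big[setU/set0]_(i < n) F i))).
  rewrite -measureU//; last by rewrite /D setDKI.
  by apply: le_measure; rewrite ?inE//; exact: measurableU.
rewrite addeC; apply: leeD; last exact: ltW.
apply: (@le_trans _ _ (\sum_(i < n) cylinder_content (F i))).
  exact: (@content_subadditive _ _ _ cylinder_content).
rewrite -(big_mkord xpredT (fun i => cylinder_content (F i))).
by apply: nneseries_lim_ge => k _ _; exact: lam_ge0.
Qed.

HB.instance Definition _ := Content_SigmaSubAdditive_isMeasure.Build _ R
  cylinder_algebra cylinder_content cylinder_content_sigma_subadditive.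

Let I : measurableType _ := g_sigma_algebraType (@measurable _ cylinder_algebra).

Let extension : set I -> \bar R := measure_extension cylinder_content.

HB.instance Definition _ := Measure.on extension.

Let extension_cyl A : cylinder_set A -> extension A = lam A.
Proof. by move=> cA; exact: (@measurable_mu_extE _ R cylinder_algebra cylinder_content A cA). Qed.

Let measurable_id_ext : measurable_fun setT (id : I -> config Z).
Proof.
apply: measurable_to_config => n _ A mA; rewrite setTI.
apply: sub_sigma_algebra; split; first exact: measurable_preimT (measurable_coord n) mA.
by exists (pickle n).+1 => x y xy; rewrite /= xy.
Qed.

(** Integrating a product of indicators replaces one factor at a time by its measure: [fct] is
    [m (A i)] for the coordinates already integrated and an indicator for the others. *)
Let lam_box (s : seq int) (A : int -> set Z) : uniq s -> (forall n, measurable (A n)) ->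
  lam [set x | forall n, n \in s -> A n (x n)] = \big[*%E/1]_(n <- s) m (A n).
Proof.
move=> us mA; set B := [set x | _].
have cB : cylinder_set B.
  split; first exact: measurable_box.
  exists (\max_(i <- s) pickle i).+1 => x y xy Bx n ns; rewrite -xy; first exact: Bx.
  by rewrite ltnS; exact: leq_bigmax_seq.
pose fct k j x (i : int) :=
  if (k <= pickle i < k + j)%N then m (A i) else (\1_(A i) (x i))%:E.
have JB k j x : J k j (ind B) x = \big[*%E/1]_(i <- s) fct k j x i.
  elim: j k x => [|j ih] k x /=.
    rewrite (eq_bigr (fun i => (\1_(A i) (x i))%:E)); last first.
      by move=> i _; rewrite /fct addn0; case: ifP => //; lia.
    case: (pselect (B x)) => [Bx|nB].
      rewrite indT// big_seq big1// => i si.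
      by rewrite indicE mem_set//; exact: Bx.
    rewrite indF//; move: nB => /existsNP[i /not_implyP[si nA]].
    by rewrite (perm_big _ (perm_to_rem si)) big_cons indicE memNset//= mul0e.
  rewrite /integrate_coord; under eq_integral do rewrite ih.
  have fE i z : pickle i != k -> fct k.+1 j (setk k z x) i = fct k j.+1 x i.
    move=> ik; rewrite /fct /setk (negbTE ik).
    by congr (if _ then _ else _); lia.
  case: (pselect (exists2 i, i \in s & pickle i = k)) => [[i si ik]|nk].
    rewrite (perm_big _ (perm_to_rem si)) big_cons.
    under eq_integral do rewrite (perm_big _ (perm_to_rem si)) big_cons.
    have rE z : \big[*%E/1]_(n <- rem i s) fct k.+1 j (setk k z x) n =
        \big[*%E/1]_(n <- rem i s) fct k j.+1 x n.
      rewrite [LHS]big_seq [RHS]big_seq; apply: eq_bigr => n.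
      rewrite mem_rem_uniq// inE => /andP[ni _]; apply: fE; rewrite -ik.
      by apply: contra ni => /eqP/(pcan_inj (@choice.pickleK _))->.
    under eq_integral do rewrite rE.
    have fct0 n y k' j' : 0 <= fct k' j' y n.
      by rewrite /fct; case: ifP => // _; rewrite lee_fin.
    rewrite (eq_integral (fun z => (\1_(A i) z)%:E *
        \big[*%E/1]_(n <- rem i s) fct k j.+1 x n)); last first.
      by move=> z _; rewrite {1}/fct ik ltnn /= /setk ik eqxx.
    rewrite ge0_integralZr//; last by apply: prode_ge0.
      rewrite integral_indic// setIT; congr (_ * _).
      by rewrite /fct ik leqnn /=; case: ifP => //; lia.
    exact/measurable_EFinP.
  rewrite (eq_integral (cst (\big[*%E/1]_(n <- s) fct k j.+1 x n))); last first.
    move=> z _; rewrite [LHS]big_seq [RHS]big_seq; apply: eq_bigr => n sn.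
    by apply: fE; apply/eqP => nk'; apply: nk; exists n.
  by rewrite integral_cst// -[RHS]mule1; congr (_ * _); exact: probability_setT.
rewrite /lam (@tail_probE 0 (maxn (rank B) (\max_(i <- s) pickle i).+1))//; last first.
  by rewrite add0n leq_maxl.
rewrite JB big_seq [RHS]big_seq; apply: eq_bigr => i si; rewrite /fct add0n ifT//=.
by rewrite leq_max ltnS (leq_bigmax_seq _ si) ?orbT.
Qed.

Let extension_box (s : seq int) (A : int -> set Z) :
  uniq s -> (forall n, measurable (A n)) ->
  extension [set x | forall n, n \in s -> A n (x n)] = \big[*%E/1]_(n <- s) m (A n).
Proof.
move=> us mA; rewrite -lam_box// -extension_cyl//.
split; first exact: measurable_box.
exists (\max_(i <- s) pickle i).+1 => x y xy Bx n ns; rewrite -xy; first exact: Bx.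
by rewrite ltnS; exact: leq_bigmax_seq.
Qed.

Let extension_setT : extension setT = 1.
Proof.
have := @extension_box [::] (fun=> setT) isT (fun=> measurableT).
by rewrite big_nil => <-; congr extension; apply/seteqP; split.
Qed.

HB.instance Definition _ := Measure_isProbability.Build _ _ _ extension extension_setT.

Lemma iid_product_exists : exists P : probability (config Z) R, is_iid_product P m.
Proof.
by exists (image_law extension measurable_id_ext) => s A us mA; exact: extension_box.
Qed.

End IidExistence.

(** * Analytic sets and Luzin's separation theorem *)

Local Notation baire := (nat -> nat).

Section Souslin.
Implicit Types (a b c : baire) (S B : set baire).

Definition eq_upto (n : nat) a b := forall i, (i < n)%N -> a i = b i.

Lemma eq_uptoW n k a b : (k <= n)%N -> eq_upto n a b -> eq_upto k a b.
Proof. by move=> kn ab i ik; apply: ab; exact: leq_trans kn. Qed.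

Lemma eq_upto_sym n a b : eq_upto n a b -> eq_upto n b a.
Proof. by move=> ab i ik; rewrite ab. Qed.

Lemma eq_upto_trans n a b c : eq_upto n a b -> eq_upto n b c -> eq_upto n a c.
Proof. by move=> ab bc i ik; rewrite ab// bc. Qed.

Lemma eq_upto_subst (h : nat -> nat) N :
  exists N', forall a b, eq_upto N' a b -> eq_upto N (a \o h) (b \o h).
Proof.
exists (\max_(i < N) h i).+1 => a b ab i iN; apply: ab.
by rewrite ltnS; exact: (leq_bigmax (Ordinal iN)).
Qed.

(** Such a relation is clopen, with a uniform bound; countable intersections of such relations are
    exactly the closed ones. *)
Definition finitary (p : baire -> baire -> Prop) := exists N, forall a a' b b',
  eq_upto N a a' -> eq_upto N b b' -> p a b -> p a' b'.

(* [S] is analytic: the projection of a closed subset of N^N x N^N. *)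
Definition souslin S := exists2 r : nat -> baire -> baire -> Prop,
  (forall n, finitary (r n)) & forall a, S a <-> exists b, forall n, r n a b.

Lemma finitary_subst (h k : nat -> nat) p :
  finitary p -> finitary (fun a b => p (a \o h) (b \o k)).
Proof.
move=> [N hN]; have [N1 h1] := eq_upto_subst h N; have [N2 h2] := eq_upto_subst k N.
exists (maxn N1 N2) => a a' b b' aa bb; apply: hN.
  by apply: h1; apply: eq_uptoW aa; rewrite leq_maxl.
by apply: h2; apply: eq_uptoW bb; rewrite leq_maxr.
Qed.

Lemma souslin_subst (h : nat -> nat) S :
  souslin S -> souslin [set a : baire | S (a \o h)].
Proof.
move=> [r fr rS]; exists (fun n a b => r n (a \o h) b).
  by move=> n; exact: (finitary_subst h id).
by move=> a; exact: rS.
Qed.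

(** Countably many witnesses, one for each [i], are interleaved into one by coding pairs with
    [pickle]. *)
Lemma souslin_bigcap (F : nat -> set baire) :
  (forall i, souslin (F i)) -> souslin (\bigcap_i F i).
Proof.
move=> sF.
have /choice[r hr] : forall i, exists r : nat -> baire -> baire -> Prop,
    (forall n, finitary (r n)) /\ forall a, F i a <-> exists b, forall n, r n a b.
  by move=> i; have [r ? ?] := sF i; exists r.
exists (fun n a b => if unpickle n is Some p then
    r p.1 p.2 a (fun j => b (pickle (p.1, j))) else True).
  move=> n; case: unpickle => [[i k]|]; last by exists 0%N.
  exact: (finitary_subst id (fun j => pickle (i, j)) ((hr i).1 k)).
move=> a; split.
  move=> aF; have /choice[b bP] : forall i, exists b, forall n, r i n a b.
    by move=> i; apply/(hr i).2; exact: aF.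
  exists (fun m => if unpickle m is Some p then b p.1 p.2 else 0%N) => n.
  case: unpickle => [[i k]|//] /=.
  rewrite (_ : (fun j => _) = b i) //.
  by apply/funext => j; rewrite pickleK.
move=> [b bP] i _; apply/(hr i).2; exists (fun j => b (pickle (i, j))) => n.
by have := bP (pickle (i, n)); rewrite pickleK.
Qed.

(** The first entry of the witness names the index; the remaining entries witness membership in that
    set. *)
Lemma souslin_bigcup (F : nat -> set baire) :
  (forall i, souslin (F i)) -> souslin (\bigcup_i F i).
Proof.
move=> sF.
have /choice[r hr] : forall i, exists r : nat -> baire -> baire -> Prop,
    (forall n, finitary (r n)) /\ forall a, F i a <-> exists b, forall n, r n a b.
  by move=> i; have [r ? ?] := sF i; exists r.
exists (fun n a b => if unpickle n is Some p then
    b 0%N = p.1 -> r p.1 p.2 a (b \o S) else True).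
  move=> n; case: unpickle => [[i k]|]; last by exists 0%N.
  have [N hN] := finitary_subst id succn ((hr i).1 k).
  exists N.+1 => a a' b b' aa bb /= h b'0; apply: (hN a _ b) => //.
  - exact: eq_uptoW aa.
  - exact: eq_uptoW bb.
  - by apply: h; rewrite bb.
move=> a; split.
  move=> [i _ /(hr i).2[b bP]].
  exists (fun j => if j is j'.+1 then b j' else i) => n.
  case: unpickle => [[j k]|//] /= <-.
  exact: bP.
move=> [b bP]; exists (b 0%N) => //; apply/(hr _).2; exists (b \o S) => n.
by have := bP (pickle (b 0%N, n)); rewrite pickleK /=; apply.
Qed.

(** Asking for both halves makes closure under complement automatic. These sets thus form a
    sigma-algebra, and preimages of measurable sets have to be examined on generators only. *)
Definition bisouslin S := souslin S /\ souslin (~` S).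

Lemma bisouslinC S : bisouslin S -> bisouslin (~` S).
Proof. by move=> [? ?]; split; rewrite ?setCK. Qed.

Lemma bisouslin_bigcup (F : nat -> set baire) :
  (forall i, bisouslin (F i)) -> bisouslin (\bigcup_i F i).
Proof.
move=> sF; split; first by apply: souslin_bigcup => i; case: (sF i).
by rewrite setC_bigcup; apply: souslin_bigcap => i; case: (sF i).
Qed.

Lemma bisouslin_subst (h : nat -> nat) S :
  bisouslin S -> bisouslin [set a : baire | S (a \o h)].
Proof. by move=> [/(souslin_subst h) ? /(souslin_subst h) ?]. Qed.

Lemma bisouslin_clopen S N :
  (forall a a', eq_upto N a a' -> S a -> S a') -> bisouslin S.
Proof.
move=> hS; split.
  exists (fun _ a _ => S a); first by move=> _; exists N => a a' b b' /hS.
  by move=> a; split=> [Sa|[_ /(_ 0%N)]//]; exists (fun=> 0%N).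
exists (fun _ a _ => ~ S a).
  by move=> _; exists N => a a' b b' /eq_upto_sym/hS aa _ nS /aa.
by move=> a; split=> [Sa|[_ /(_ 0%N)]//]; exists (fun=> 0%N).
Qed.

Lemma bisouslin0 : bisouslin set0.
Proof. exact: (@bisouslin_clopen _ 0). Qed.

Lemma bisouslinI S B : bisouslin S -> bisouslin B -> bisouslin (S `&` B).
Proof.
move=> hS hB; rewrite -[_ `&` _]setCK setCI; apply: bisouslinC.
rewrite -bigcup2E; apply: bisouslin_bigcup => -[|[|i]] /=.
- exact: bisouslinC.
- exact: bisouslinC.
- exact: bisouslin0.
Qed.

(** An open set is the union of the basic clopen sets it contains, and these are coded by finite
    prefixes. *)
Lemma bisouslin_open S :
  (forall a, S a -> exists k, forall a', eq_upto k a a' -> S a') -> bisouslin S.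
Proof.
move=> oS; pose F n := [set a | if unpickle n is Some s then
  mkseq a (size s) = s /\ forall a', mkseq a' (size s) = s -> S a' else False].
have mkE n a b : eq_upto n a b <-> mkseq a n = mkseq b n.
  split=> [ab|ab i iN].
    by apply/eq_in_map => i; rewrite mem_iota => /andP[_]; exact: ab.
  by rewrite -(nth_mkseq 0%N a iN) ab nth_mkseq.
rewrite (_ : S = \bigcup_n F n).
  apply: bisouslin_bigcup => n; rewrite /F; case: unpickle => [s|].
    apply: (@bisouslin_clopen _ (size s)) => a a' /mkE aa /= [h1 h2].
    by split => //; rewrite -aa.
  exact: (@bisouslin_clopen _ 0).
apply/seteqP; split=> [a Sa|a [n _]]; last first.
  by rewrite /F /mkset; case: unpickle => [s [h1 h2]|//]; exact: h2 _ h1.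
have [k hk] := oS a Sa; exists (pickle (mkseq a k)) => //.
rewrite /F /mkset pickleK size_mkseq; split => // a' aa'.
by apply: hk; apply/mkE.
Qed.

End Souslin.

Section Luzin.
Context d (T : measurableType d).
Implicit Types (A X : set T).

Let separable X X' := exists2 A, measurable A & X `<=` A /\ X' `<=` ~` A.

Let separable_bigcup (X X' : nat -> set T) :
  (forall i j, separable (X i) (X' j)) -> separable (\bigcup_i X i) (\bigcup_j X' j).
Proof.
move=> h; have /choice[A hA] : forall p : nat * nat, exists A, measurable A /\
    (X p.1 `<=` A /\ X' p.2 `<=` ~` A).
  by move=> [i j]; have [A ? ?] := h i j; exists A.
exists (\bigcup_i \bigcap_j A (i, j)).
  apply: bigcupT_measurable => i; apply: bigcapT_measurable => j.
  by have [] := hA (i, j).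
split; first by move=> x [i _ Xi]; exists i => // j _; exact: (hA (i, j)).2.1.
by move=> x [j _ X'j] [i _ /(_ j I)]; exact: (hA (i, j)).2.2.
Qed.

Let setn (k n : nat) (c : baire) : baire := fun i => if i == k then n else c i.

(* Luzin's separation theorem: if the two analytic sets could not be separated,
   one could refine two nested sequences of non-separable pieces, whose limit
   points have the same image. *)
Lemma luzin_separation (G G' : baire -> T) (B : nat -> set T)
    (r r' : nat -> baire -> Prop) :
  (forall i, measurable (B i)) ->
  (forall i c, B i (G c) -> exists k, forall c', eq_upto k c c' -> B i (G c')) ->
  (forall i c, B i (G' c) -> exists k, forall c', eq_upto k c c' -> B i (G' c')) ->
  (forall x y, x <> y -> exists i j, [/\ B i x, B j y & B i `&` B j = set0]) ->
  (forall n, exists N, forall c c', eq_upto N c c' -> r n c -> r n c') ->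
  (forall n, exists N, forall c c', eq_upto N c c' -> r' n c -> r' n c') ->
  (forall c c', (forall n, r n c) -> (forall n, r' n c') -> G c <> G' c') ->
  exists2 A, measurable A &
    (forall c, (forall n, r n c) -> A (G c)) /\
    (forall c, (forall n, r' n c) -> ~ A (G' c)).
Proof.
move=> mB oG oG' hausB fr fr' dis.
pose X k c := [set x | exists c', [/\ eq_upto k c c', forall n, r n c' & G c' = x]].
pose X' k c := [set x | exists c', [/\ eq_upto k c c', forall n, r' n c' & G' c' = x]].
suff : separable (X 0%N (fun=> 0%N)) (X' 0%N (fun=> 0%N)).
  move=> [A mA [XA X'A]]; exists A => //; split=> c hc.
    by apply: XA; exists c.
  by apply: X'A; exists c.
apply: contrapT => nsep.
have step k c c' : ~ separable (X k c) (X' k c') ->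
    exists i j, ~ separable (X k.+1 (setn k i c)) (X' k.+1 (setn k j c')).
  move=> h; apply: contrapT => h'.
  have E u v : eq_upto k u v -> eq_upto k.+1 (setn k (v k) u) v.
    move=> uv i; rewrite /setn ltnS leq_eqVlt; case: eqP => [->//|_] /=.
    exact: uv.
  have {}h' i j : separable (X k.+1 (setn k i c)) (X' k.+1 (setn k j c')).
    by apply: contrapT => nS; apply: h'; exists i, j.
  apply: h; have [A mA [XA X'A]] := separable_bigcup h'.
  exists A => //; split=> x [b [/E cb rb bx]].
    by apply: XA; exists (b k) => //; exists b.
  by apply: X'A; exists (b k) => //; exists b.
have /choice[nx nxP] : forall p : nat * (baire * baire), exists ij : nat * nat,
    ~ separable (X p.1 p.2.1) (X' p.1 p.2.2) ->
    ~ separable (X p.1.+1 (setn p.1 ij.1 p.2.1)) (X' p.1.+1 (setn p.1 ij.2 p.2.2)).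
  move=> [k [c c']] /=; case: (pselect (separable (X k c) (X' k c'))) => h.
    by exists (0%N, 0%N).
  by have [i [j ij]] := step _ _ _ h; exists (i, j).
pose u := fix u k : baire * baire := if k is k'.+1 then
  let p := nx (k', u k') in (setn k' p.1 (u k').1, setn k' p.2 (u k').2)
  else (fun=> 0%N, fun=> 0%N).
have uns k : ~ separable (X k (u k).1) (X' k (u k).2).
  by elim: k => [//|k ih]; exact: (nxP (k, u k)).
have u1 k j : eq_upto k (u (k + j)%N).1 (u k).1.
  elim: j => [|j ih]; first by rewrite addn0.
  by move=> i ik; rewrite addnS /= /setn; case: eqP => [e|_]; [lia|exact: ih].
have u2 k j : eq_upto k (u (k + j)%N).2 (u k).2.
  elim: j => [|j ih]; first by rewrite addn0.
  by move=> i ik; rewrite addnS /= /setn; case: eqP => [e|_]; [lia|exact: ih].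
pose c i := (u i.+1).1 i; pose c' i := (u i.+1).2 i.
have cE k : eq_upto k c (u k).1.
  by move=> i ik; rewrite /c -(subnKC ik) u1.
have c'E k : eq_upto k c' (u k).2.
  by move=> i ik; rewrite /c' -(subnKC ik) u2.
(* A piece without members would be separated trivially, so every prefix of [c] extends to a member
   of the closed set, which therefore contains [c]. *)
have rc n : r n c.
  have [N hN] := fr n.
  have [b [cb rb _]] : exists b, [/\ eq_upto N (u N).1 b, forall n, r n b & G b = G b].
    apply: contrapT => h; apply: (uns N); exists set0 => //; split; last by rewrite setC0.
    by move=> x [b [h1 h2 h3]]; apply: h; exists b.
  by apply: hN (rb n); apply: eq_upto_sym; exact: eq_upto_trans (cE N) cb.
have rc' n : r' n c'.
  have [N hN] := fr' n.
  have [b [cb rb _]] : exists b, [/\ eq_upto N (u N).2 b, forall n, r' n b & G b = G b].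
    apply: contrapT => h; apply: (uns N); exists setT => //; split => //.
    by move=> x [b [h1 h2 h3]]; case: h; exists b.
  by apply: hN (rb n); apply: eq_upto_sym; exact: eq_upto_trans (c'E N) cb.
(* By continuity, disjoint basic sets around the two limit images already separate the pieces over a
   long enough prefix. *)
have [i [j [Bi Bj ij]]] := hausB _ _ (dis _ _ rc rc').
have [k hk] := oG _ _ Bi; have [k' hk'] := oG' _ _ Bj.
apply: (uns (maxn k k')); exists (B i) => //; split=> x [b [cb _ <-]].
  apply: hk; apply: eq_uptoW (eq_upto_trans (cE _) cb); exact: leq_maxl.
move=> Bib; have Bjb : B j (G' b).
  by apply: hk'; apply: eq_uptoW (eq_upto_trans (c'E _) cb); exact: leq_maxr.
by have : (B i `&` B j) (G' b) by []; rewrite ij.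
Qed.

End Luzin.

(** * Borel inverses of injective measurable maps *)

Section Coded.

(* The consequences of standardness needed for Luzin's theorem: a continuous
   surjection [g] from N^N, continuity being tested on a countable Hausdorff
   family [B] of measurable sets. *)
Definition coding d (T : measurableType d) (g : baire -> T) (B : nat -> set T) :=
  [/\ forall t, exists a, g a = t,
      forall i, measurable (B i),
      forall A, measurable A -> bisouslin (g @^-1` A),
      forall i a, B i (g a) -> exists k, forall a', eq_upto k a a' -> B i (g a') &
      forall x y, x <> y -> exists i j, [/\ B i x, B j y & B i `&` B j = set0]].

Definition coded d (T : measurableType d) := exists g B, @coding d T g B.

Lemma coded_prod d1 d2 (T1 : measurableType d1) (T2 : measurableType d2) :
  coded T1 -> coded T2 -> coded (T1 * T2)%type.
Proof.
move=> [g1 [B1 [s1 m1 b1 o1 h1]]] [g2 [B2 [s2 m2 b2 o2 h2]]].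
pose g (a : baire) := (g1 (a \o double), g2 (a \o (fun i => i.*2.+1))).
pose B n : set (T1 * T2) := if unpickle n is Some p then
  (if p.1 : bool then [set x | B1 p.2 x.1] else [set x | B2 p.2 x.2]) else set0.
exists g, B; split.
- move=> [t1 t2]; have [a1 <-] := s1 t1; have [a2 <-] := s2 t2.
  exists (fun i => if odd i then a2 i./2 else a1 i./2); rewrite /g; congr (g1 _, g2 _).
    by apply/funext => i; rewrite /= odd_double doubleK.
  by apply/funext => i; rewrite /= odd_double /= uphalf_double.
- move=> n; rewrite /B; case: unpickle => [[[] i]|//] /=.
    exact (measurable_preimT measurable_fst (m1 i)).
  exact (measurable_preimT measurable_snd (m2 i)).
- apply: smallest_sub; first split.
  + by rewrite preimage_set0; exact: bisouslin0.
  + by move=> A hA; rewrite setTD; exact: bisouslinC.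
  + by move=> F hF; rewrite preimage_bigcup; exact: bisouslin_bigcup.
  move=> _ [[A mA <-]|[A mA <-]]; rewrite setTI.
    exact: bisouslin_subst (b1 _ mA).
  exact: bisouslin_subst (b2 _ mA).
- move=> n a; rewrite /B; case: unpickle => [[[] i]|//] /=.
    move=> /o1[k hk]; have [N hN] := eq_upto_subst double k.
    by exists N => a' aa'; apply: hk; exact: hN.
  move=> /o2[k hk]; have [N hN] := eq_upto_subst (fun i => i.*2.+1) k.
  by exists N => a' aa'; apply: hk; exact: hN.
- move=> [x1 x2] [y1 y2] xy; case: (pselect (x1 = y1)) => [e|/h1].
    have /h2[i [j [Bi Bj ij]]] : x2 <> y2 by move=> e2; apply: xy; rewrite e e2.
    exists (pickle (false, i)), (pickle (false, j)); rewrite /B !pickleK; split => //.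
    by apply/seteqP; split => // t [/= h h']; have : (B2 i `&` B2 j) t.2 by []; rewrite ij.
  move=> [i [j [Bi Bj ij]]].
  exists (pickle (true, i)), (pickle (true, j)); rewrite /B !pickleK; split => //.
  by apply/seteqP; split => // t [/= h h']; have : (B1 i `&` B1 j) t.1 by []; rewrite ij.
Qed.

Lemma coded_config d (Z : measurableType d) : coded Z -> coded (config Z).
Proof.
move=> [g0 [B0 [s0 m0 b0 o0 h0]]].
pose h (n : int) (i : nat) := pickle (n, i).
pose g (a : baire) : config Z := fun n => g0 (a \o h n).
pose B n : set (config Z) := if unpickle n is Some p then
  [set x | B0 p.2 (x (p.1 : int))] else set0.
exists g, B; split.
- move=> t; have /choice[a ha] := fun n => s0 (t n).
  exists (fun m => if unpickle m is Some p then a p.1 p.2 else 0%N).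
  apply/funext => n; rewrite -[RHS]ha /g; congr g0; apply/funext => i.
  by rewrite /= /h pickleK.
- move=> n; rewrite /B; case: unpickle => [[k i]|//] /=.
  exact (measurable_preimT (measurable_coord k) (m0 i)).
- apply: smallest_sub; first split.
  + by rewrite preimage_set0; exact: bisouslin0.
  + by move=> A hA; rewrite setTD; exact: bisouslinC.
  + by move=> F hF; rewrite preimage_bigcup; exact: bisouslin_bigcup.
  move=> _ [n [A [mA ->]]]; exact: bisouslin_subst (b0 _ mA).
- move=> n a; rewrite /B; case: unpickle => [[k i]|//] /=.
  move=> /o0[l hl]; have [N hN] := eq_upto_subst (h k) l.
  by exists N => a' aa'; apply: hl; exact: hN.
- move=> x y xy; have [n xyn] : exists n, x n <> y n.
    by apply/existsNP => e; apply: xy; apply/funext.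
  have [i [j [Bi Bj ij]]] := h0 _ _ xyn.
  exists (pickle (n, i)), (pickle (n, j)); rewrite /B !pickleK; split => //.
  by apply/seteqP; split => // t [/= h1 h2]; have : (B0 i `&` B0 j) (t n) by []; rewrite ij.
Qed.

(** Since [f] composed with [gY] is only Borel, Luzin's theorem is applied to its graph: even
    entries code a point of [Y], odd entries its image, and the projection to the image is
    continuous. A second interleaving adds the witness of analyticity. *)
Lemma separation_of_images d1 d2 (Y : measurableType d1) (T : measurableType d2)
    (f : Y -> T) (C C' : set Y) :
  coded Y -> coded T -> measurable_fun setT f -> measurable C -> measurable C' ->
  (forall y y', C y -> C' y' -> f y <> f y') ->
  exists2 A, measurable A & C `<=` f @^-1` A /\ C' `<=` f @^-1` (~` A).
Proof.
move=> [gY [_ [sY _ bY _ _]]] [gT [B [sT mB bT oT hT]]] mf mC mC' CC'.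
pose ev (a : baire) := a \o double; pose od (a : baire) := a \o (fun i => i.*2.+1).
pose mix (a b : baire) i := if odd i then b i./2 else a i./2.
have evE a b : ev (mix a b) = a.
  by apply/funext => i; rewrite /ev /mix /= odd_double doubleK.
have odE a b : od (mix a b) = b.
  by apply/funext => i; rewrite /od /mix /= odd_double /= uphalf_double.
have bis (D : set Y) : measurable D ->
    bisouslin [set a | D (gY (ev a)) /\ f (gY (ev a)) = gT (od a)].
  move=> mD; apply: bisouslinI; first exact: (bisouslin_subst double (bY _ mD)).
  (* Two points of [T] differ exactly when disjoint members of the family [B] contain them, so
     inequality is a countable union of conditions of the required kind. *)
  rewrite -[X in bisouslin X]setCK; apply: bisouslinC.
  pose E n := if unpickle n is Some p then
    (if pselect (B p.1 `&` B p.2 = set0) then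
       [set a | B p.1 (f (gY (ev a)))] `&` [set a | B p.2 (gT (od a))] else set0)
    else set0.
  rewrite (_ : ~` _ = \bigcup_n E n).
    apply: bisouslin_bigcup => n; rewrite /E; case: unpickle => [[i j]|]; last exact: bisouslin0.
    case: pselect => ? /=; last exact: bisouslin0.
    apply: bisouslinI.
      exact: (bisouslin_subst double (bY _ (measurable_preimT mf (mB i)))).
    exact: (bisouslin_subst (fun i => i.*2.+1) (bT _ (mB j))).
  apply/seteqP; split => a /=.
    move=> /hT[i [j [Bi Bj ij]]]; exists (pickle (i, j)) => //; rewrite /E pickleK /=.
    by case: pselect.
  move=> [n _]; rewrite /E; case: unpickle => [[i j]|//] /=; case: pselect => // ij [/= h1 h2] e.
  have : (B i `&` B j) (gT (od a)) by split => //; rewrite -e.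
  by rewrite ij.
have [[r fr rS] _] := bis C mC; have [[r' fr' rS'] _] := bis C' mC'.
have oG i c : B i (gT (od (ev c))) ->
    exists k, forall c', eq_upto k c c' -> B i (gT (od (ev c'))).
  move=> /oT[k hk].
  have [N hN] := eq_upto_subst (double \o (fun i => i.*2.+1)) k.
  by exists N => c' cc'; apply: hk; exact: (hN _ _ cc').
have fin (q : nat -> baire -> baire -> Prop) n : finitary (q n) ->
    exists N, forall c c', eq_upto N c c' -> q n (ev c) (od c) -> q n (ev c') (od c').
  move=> fq; have [N hN] := finitary_subst double (fun i => i.*2.+1) fq.
  by exists N => c c' cc'; exact: hN.
have [||||A mA [CA C'A]] := @luzin_separation _ T (gT \o od \o ev) (gT \o od \o ev) B
  (fun n c => r n (ev c) (od c)) (fun n c => r' n (ev c) (od c)) mB oG oG.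
- by [].
- by move=> n; exact: fin.
- by move=> n; exact: fin.
- move=> c c' rc rc' /=.
  have [] := (rS (ev c)).2; first by exists (od c).
  have [] := (rS' (ev c')).2; first by exists (od c').
  by move=> /= h1 <- h2 <-; exact: CC'.
exists A => //; split=> y hy /=.
  have [a ya] := sY y; have [b fb] := sT (f y).
  have [|c hc] := (rS (mix a b)).1; first by rewrite /= evE odE ya fb.
  have := CA (mix (mix a b) c) => /=; rewrite !evE !odE fb; exact.
have [a ya] := sY y; have [b fb] := sT (f y).
have [|c hc] := (rS' (mix a b)).1; first by rewrite /= evE odE ya fb.
have := C'A (mix (mix a b) c) => /=; rewrite !evE !odE fb; exact.
Qed.

(** By injectivity over [N], the parts of [C] and of its complement lying over [N] have disjoint
    images. A measurable set separating them cuts out of [N] exactly the image of [C], that is, the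
    preimage of [C] under the inverse. *)
Lemma measurable_section d1 d2 (Y : measurableType d1) (T : measurableType d2)
    (f : Y -> T) (N : set T) :
  coded Y -> coded T -> measurable_fun setT f -> measurable N ->
  (forall t, N t -> exists y, f y = t) ->
  (forall y y', N (f y) -> f y = f y' -> y = y') ->
  exists2 s : T -> Y, measurable_fun setT s & forall y, N (f y) -> s (f y) = y.
Proof.
move=> cY cT mf mN exf inf.
pose s t := if `[< N t >] then xget point [set y | f y = t] else point.
have sE y : N (f y) -> s (f y) = y.
  move=> Ny; rewrite /s; case: asboolP => // _; case: xgetP => [y' _ fy'|/(_ y) h]; last by case: h.
  by apply/esym/inf => //; rewrite fy'.
exists s => // _ C mC; rewrite setTI.
have mN' := measurable_preimT mf mN.
have [|y y' [Cy Ny] [Cy' _] e|A mA [CA C'A]] := @separation_of_images _ _ Y T f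
   (C `&` f @^-1` N) (~` C `&` f @^-1` N) cY cT mf (measurableI _ _ mC mN').
- by apply: measurableI => //; exact: measurableC.
- by apply: Cy'; rewrite -(inf _ _ Ny e).
(* The last term accounts for the default value [point] taken off [N]. *)
rewrite (_ : s @^-1` C = (A `&` N) `|` (~` N `&` [set _ | C point])).
  apply: measurableU; first exact: measurableI.
  apply: measurableI; first exact: measurableC.
  case: (pselect (C point)) => h.
    by rewrite (_ : [set _ | _] = setT)//; apply/seteqP; split.
  by rewrite (_ : [set _ | _] = set0)//; apply/seteqP; split.
apply/seteqP; split => t /=.
  case: (pselect (N t)) => Nt.
    have [y fy] := exf t Nt; rewrite -fy sE ?fy// => Cy; left; split => //.
    by rewrite -fy; apply: CA; rewrite /= fy.
  by rewrite /s; case: asboolP => // _ Cp; right.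
move=> [[At Nt]|[Nt Cp]]; last by rewrite /s; case: asboolP.
have [y fy] := exf t Nt; rewrite -fy sE ?fy//.
by apply: contrapT => nC; have := C'A y; rewrite /= fy; apply.
Qed.

End Coded.

(** * Polish spaces *)

Section PolishCoded.
Context {R : realType} {d : measure_display} (T : measurableType d).

Let rad (k : nat) : R := (1 / 2) ^+ k.

Let rad_gt0 k : 0 < rad k.
Proof. by apply: exprn_gt0; lra. Qed.

Let radS k : rad k = 2 * rad k.+1.
Proof. by rewrite /rad exprS; lra. Qed.

Let rad_small (e : R) : 0 < e -> exists k, rad k < e.
Proof.
move=> e0; have [k hk] : exists k : nat, e^-1 < k%:R.
  by exists (Num.bound e^-1); apply: archi_boundP; rewrite invr_ge0 ltW.
exists k; rewrite /rad div1r exprVn invf_plt ?posrE ?exprn_gt0//.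
by apply: (lt_le_trans hk); rewrite -natrX ler_nat ltnW// ltn_expl.
Qed.

(** A sequence [a] proposes points [e (a k)] of the dense set; a proposal not closer to the current
    point than the current radius is declined. Hence every [a] yields a Cauchy sequence, and its
    limit [g a] is within [2 * rad k] of a point determined by the first [k + 1] entries. *)
Lemma polish_coded : @polish_borel R d T -> coded T.
Proof.
move=> [dist [[d0 dE dC dT] comp [D [cD sD]] bor]].
have distxx x : dist x x = 0 by apply/dE.
have [f injf] : exists f : T -> nat, {in D &, injective f}.
  by move/countable_injP : cD => [f injf]; exists f.
pose e n := xget point [set t | D t /\ f t = n].
have eD x r : 0 < r -> exists n, dist (e n) x < r.
  move=> /(sD x)[y Dy xy]; exists (f y); rewrite /e; case: xgetP => [y' _ [Dy' fy]|/(_ y) h].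
    by rewrite (injf y' y) ?inE// dC.
  by case: h.
pose z := fix z (a : nat -> nat) k := if k is k'.+1 then
  (if dist (z a k') (e (a k)) < rad k' then e (a k) else z a k') else e (a 0%N).
have zS a k : dist (z a k) (z a k.+1) < rad k.
  by rewrite /=; case: ifP => // _; rewrite distxx.
have zD a k j : dist (z a k) (z a (k + j)%N) <= 2 * rad k - 2 * rad (k + j).
  elim: j => [|j ih]; first by rewrite addn0 distxx subrr.
  have := dT (z a k) (z a (k + j)%N) (z a (k + j).+1).
  have := zS a (k + j)%N; have := radS (k + j); rewrite addnS; lra.
have zloc a a' k : eq_upto k.+1 a a' -> z a k = z a' k.
  elim: k => [|k ih] aa /=; first by rewrite aa.
  by rewrite ih ?aa//; exact: eq_uptoW aa.
have /choice[g gP] : forall a, exists l, forall k, dist (z a k) l <= 2 * rad k.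
  move=> a; have [eps eps0|l lP] := comp (z a).
    have [N hN] : exists N, rad N < eps / 4 by apply: rad_small; lra.
    exists N => m n Nm Nn; have := zD a N (m - N)%N; have := zD a N (n - N)%N.
    rewrite !subnKC//; have := rad_gt0 m; have := rad_gt0 n.
    have := dT (z a m) (z a N) (z a n); rewrite (dC (z a m) (z a N)); lra.
  exists l => k; apply/ler_addgt0Pr => eps eps0.
  have [N /(_ (maxn N k) (leq_maxl _ _)) hN] := lP _ eps0.
  have := zD a k (maxn N k - k)%N; rewrite subnKC ?leq_maxr//.
  have := dT (z a k) (z a (maxn N k)) l; have := rad_gt0 (maxn N k); lra.
have gO O a : metric_open dist O -> O (g a) ->
    exists k, forall a', eq_upto k a a' -> O (g a').
  move=> oO /oO[r r0 rO]; have [k hk] : exists k, rad k < r / 4 by apply: rad_small; lra.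
  exists k.+1 => a' /zloc aa; apply: rO.
  have := gP a k; have := gP a' k; rewrite aa => h1 h2.
  have := dT (g a) (z a' k) (g a'); rewrite (dC (g a) (z a' k)); lra.
pose B n := if unpickle n is Some p then [set t | dist (e p.1) t < rad p.2] else set0.
have oB n : metric_open dist (B n).
  rewrite /B; case: unpickle => [[i k]|//] x /= xk.
  exists (rad k - dist (e i) x); first by lra.
  by move=> y xy; have := dT (e i) x y; lra.
have mO O : metric_open dist O -> measurable O.
  by move=> oO; apply/bor; exact: sub_sigma_algebra.
exists g, B; split.
(* With accuracy [rad k / 4], consecutive proposals differ by less than [rad k], so none is declined
   and the limit is [t]. *)
- move=> t; have /choice[a aP] := fun k => eD t (rad k / 4) ltac:(have := rad_gt0 k; lra).
  have zE k : z a k = e (a k).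
    elim: k => [//|k ih] /=; rewrite ih ifT//.
    have := dT (e (a k)) t (e (a k.+1)); rewrite (dC t (e (a k.+1))).
    have := aP k; have := aP k.+1; have := radS k; have := rad_gt0 k.+1; lra.
  exists a; apply/dE/le_anti; rewrite d0 andbT; apply/ler_addgt0Pr => eps eps0.
  have [k hk] : exists k, rad k < eps / 4 by apply: rad_small; lra.
  have := gP a k; rewrite zE => h; have := aP k.
  have := dT (g a) (e (a k)) t; rewrite (dC (g a) (e (a k))); lra.
- by move=> i; exact: mO.
- move=> A /bor; move: A; apply: smallest_sub; first split.
  + by rewrite preimage_set0; exact: bisouslin0.
  + by move=> A hA; rewrite setTD; exact: bisouslinC.
  + by move=> F hF; rewrite preimage_bigcup; exact: bisouslin_bigcup.
  by move=> O oO; apply: bisouslin_open => a; exact: gO.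
- by move=> i a; exact: gO.
- move=> x y xy; have xy0 : 0 < dist x y.
    by rewrite lt_neqAle d0 andbT; apply/eqP => /esym/dE.
  have [k hk] : exists k, rad k < dist x y / 4 by apply: rad_small; lra.
  have [i hi] := eD x _ (rad_gt0 k); have [j hj] := eD y _ (rad_gt0 k).
  exists (pickle (i, k)), (pickle (j, k)); rewrite /B !pickleK; split => //.
  apply/seteqP; split => // t [/= h1 h2].
  have := dT x (e i) y; have := dT (e i) t y; have := dT t (e j) y.
  by rewrite (dC x (e i)) (dC t (e j)); lra.
Qed.

End PolishCoded.

(** * Diagonals of the lattice *)

Section Diagonals.

(* One diagonal [n + t = s] of the lattice is the sequence [k |-> (x_k^{s-k}, u_{k-1}^{s-k})];
   [step F] maps it to the next diagonal when [F] acts on the sites of this one. *)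
Definition step (A B A' B' : Type) (F : A * B -> A' * B') (w : int -> A * B) :
  int -> A' * B' := fun k => ((F (w k)).1, (F (w (k - 1))).2).

Definition back (A B A' B' : Type) (Finv : A' * B' -> A * B) (v : int -> A' * B') :
  int -> A * B := fun k => Finv ((v k).1, (v (k + 1)).2).

Definition shift (A : Type) (a : int) (w : int -> A) : int -> A := fun k => w (k + a).

Lemma stepK (A B A' B' : Type) (F : A * B -> A' * B') Finv :
  cancel F Finv -> cancel (step F) (back Finv).
Proof.
move=> FK w; apply/funext => k; rewrite /back /step /= addrK.
by rewrite -surjective_pairing FK.
Qed.

Lemma backK (A B A' B' : Type) (F : A * B -> A' * B') Finv :
  cancel Finv F -> cancel (back Finv) (step F).
Proof.
move=> FK v; apply/funext => k; rewrite /back /step !FK /= subrK.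
by rewrite -surjective_pairing.
Qed.

Lemma step_shift (A B A' B' : Type) (F : A * B -> A' * B') a w :
  step F (shift a w) = shift a (step F w).
Proof. by apply/funext => k; rewrite /step /shift addrAC. Qed.

Lemma back_shift (A B A' B' : Type) (F : A' * B' -> A * B) a w :
  back F (shift a w) = shift a (back F w).
Proof. by apply/funext => k; rewrite /back /shift addrAC. Qed.

Section Powers.
Context {W : Type}.
Variables G Gi : W -> W.

Definition zpow (j : int) (w : W) : W :=
  match j with Posz n => iter n G w | Negz n => iter n.+1 Gi w end.

Hypotheses (GK : cancel G Gi) (GiK : cancel Gi G).

Lemma zpowS j w : zpow (j + 1) w = G (zpow j w).
Proof.
case: j => n; first by rewrite -PoszD addn1.
case: n => [|n]; first by rewrite /= GiK.
by rewrite (_ : Negz n.+1 + 1 = Negz n)/= ?GiK//; lia.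
Qed.

(** Serves to recognize the iterates in any family obeying the recursion, such as the diagonals of a
    given solution. *)
Lemma zpow_uniq (h : int -> W) : (forall j, h (j + 1) = G (h j)) ->
  forall j, zpow j (h 0) = h j.
Proof.
move=> hG; case=> n.
  by elim: n => [//|n /= ->]; rewrite -hG -PoszD addn1.
have hGi j : Gi (h j) = h (j - 1) by rewrite -[in LHS](subrK 1 j) hG GK.
elim: n => [|n ih]; first by rewrite /= hGi.
rewrite (_ : zpow (Negz n.+1) (h 0) = Gi (zpow (Negz n) (h 0)))// ih hGi.
by congr h; lia.
Qed.

Lemma zpowSr j w : zpow (j + 1) w = zpow j (G w).
Proof.
have H i : zpow (i + 1 + 1) w = G (zpow (i + 1) w) by rewrite zpowS.
exact: esym (@zpow_uniq (fun i => zpow (i + 1) w) H j).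
Qed.

End Powers.

End Diagonals.

Section Lattice.
Context {X X' U U' : Type}.
Variables (F : X * U -> X' * U') (Finv : X' * U' -> X * U).
Hypotheses (FK : cancel F Finv) (FinvK : cancel Finv F).
Implicit Types (w : int -> X * U) (v e : int -> X' * U').

Definition next2 w : int -> X * U := step Finv (step F w).
Definition prev2 w : int -> X * U := back Finv (back F w).

Lemma next2K : cancel next2 prev2.
Proof. by move=> w; rewrite /next2 /prev2 (stepK FinvK) (stepK FK). Qed.

Lemma prev2K : cancel prev2 next2.
Proof. by move=> w; rewrite /next2 /prev2 (backK FinvK) (backK FK). Qed.

(* The diagonal [n + t = 2 j] in terms of the diagonal [n + t = 0]. *)
Definition diag (j : int) w : int -> X * U := zpow next2 prev2 j w.

Lemma diagS j w : diag (j + 1) w = next2 (diag j w).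
Proof. by rewrite /diag zpowS//; exact: prev2K. Qed.

Lemma diagSr j w : diag (j + 1) w = diag j (next2 w).
Proof. by rewrite /diag zpowSr//; [exact: next2K|exact: prev2K]. Qed.

Lemma next2_shift a w : next2 (shift a w) = shift a (next2 w).
Proof. by rewrite /next2 !step_shift. Qed.

Lemma diag_shift a j w : diag j (shift a w) = shift a (diag j w).
Proof.
have H i : shift a (diag (i + 1) w) = next2 (shift a (diag i w)).
  by rewrite diagS next2_shift.
exact: (@zpow_uniq _ _ _ next2K (fun i => shift a (diag i w)) H j).
Qed.

(** Site [(2 * k, 0)] lies on the diagonal [n + t = 2 * k] and site [(2 * k + 1, 0)] on the one
    after it, each at the index equal to its position. *)
Definition row w : int -> X * X' :=
  fun k => ((diag k w (2 * k)).1, (step F (diag k w) (2 * k + 1)).1).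

(** Two diagonals ahead and two indices to the right, the origin becomes the site [(2, 0)], one pair
    further along the same row. *)
Lemma row_shift2 w k : row (shift 2 (next2 w)) k = row w (k + 1).
Proof.
rewrite /row diag_shift step_shift -diagSr /shift.
by congr (_, _); congr fst; congr (_ _); lia.
Qed.

(** The cut at [n] passes between the carrier entering the site and the variable sitting there:
    [agreeL n] controls the former, [agreeR n] the latter, and together they cover every entry
    once. *)
Definition agreeR n w w' := (forall k : int, n <= k -> (w k).1 = (w' k).1) /\
  (forall k : int, n < k -> (w k).2 = (w' k).2).

Definition agreeL (A B : Type) n (w w' : int -> A * B) :=
  (forall k : int, k < n -> (w k).1 = (w' k).1) /\
  (forall k : int, k <= n -> (w k).2 = (w' k).2).

End Lattice.

(** The unknown carrier at [n] spoils only the two outputs of that site, so the cut advances by one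
    index per diagonal. *)
Lemma agreeR_step (X X' U U' : Type) (F : X * U -> X' * U') n w w' :
  agreeR n w w' -> agreeR (n + 1) (step F w) (step F w').
Proof.
move=> [h1 h2]; have h k : n < k -> w k = w' k.
  move=> nk; rewrite [LHS]surjective_pairing [RHS]surjective_pairing h1 ?h2//; lia.
by split=> k hk; rewrite /step /= h//; lia.
Qed.

Lemma agreeL_back (X X' U U' : Type) (F : X * U -> X' * U') n w w' :
  agreeL n w w' -> forall k, k < n -> back F w k = back F w' k.
Proof. by move=> [h1 h2] k kn; rewrite /back h1// h2//; lia. Qed.

Lemma agreeL_lt (A B : Type) (n : int) (w w' : int -> A * B) :
  (forall k, k < n -> w k = w' k) -> agreeL (n - 1) w w'.
Proof. by move=> h; split=> k kn; rewrite h//; lia. Qed.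

Section LatticeRow.
Context {X X' U U' : Type}.
Variables (F : X * U -> X' * U') (Finv : X' * U' -> X * U).
Hypotheses (FK : cancel F Finv) (FinvK : cancel Finv F).
Implicit Types (w : int -> X * U) (v e : int -> X' * U').
Local Notation row := (row F Finv).
Local Notation diag := (diag F Finv).

(** The cut advances at the same speed as the site where the row meets the diagonal, and so never
    passes it. *)
Lemma row_agreeR w w' : agreeR 0 w w' -> forall k, 0 <= k -> row w k = row w' k.
Proof.
move=> h [] // n _.
have hn : agreeR (2 * n%:Z) (diag n w) (diag n w').
  elim: n => [//|n ih].
  have -> : Posz n.+1 = n%:Z + 1 by lia.
  rewrite !diagS// /next2.
  have -> : 2 * (n%:Z + 1) = 2 * n%:Z + 1 + 1 by lia.
  by do 2 apply: agreeR_step.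
rewrite /row hn.1//; congr (_, _).
by apply: (agreeR_step F hn).1; lia.
Qed.

(** Time-reversed counterpart of [row_agreeR]. Agreement is assumed on the diagonal [n + t = -1],
    where the outgoing carrier is read. *)
Lemma row_agreeL_back w w' :
  (forall k, k < 0 -> back F w k = back F w' k) ->
  forall k, k < 0 -> row w k = row w' k.
Proof.
move=> h [] // n _.
pose H v := back F (back Finv v).
have E u : diag (Negz n) u = back Finv (iter n H (back F u)).
  rewrite -[LHS]/(iter n.+1 (prev2 F Finv) u); elim: n => [//|n ih].
  by rewrite iterS ih.
have hn k : k < - (2 * n%:Z) -> iter n H (back F w) k = iter n H (back F w') k.
  elim: n {E} k => [|n ih] k kn; first by apply: h; lia.
  apply: (@agreeL_back _ _ _ _ _ (- (2 * n%:Z) - 1 - 1)); last by lia.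
  by apply: agreeL_lt => l; apply: agreeL_back; exact: agreeL_lt.
rewrite /row !E !backK//; congr (_, _).
  rewrite (@agreeL_back _ _ _ _ Finv (- (2 * n%:Z) - 1) _ (iter n H (back F w')))//.
    exact: agreeL_lt.
  by lia.
by rewrite hn//; lia.
Qed.

Lemma row_agreeL w w' : agreeL 0 w w' -> forall k, k < 0 -> row w k = row w' k.
Proof. by move=> h; apply: row_agreeL_back; exact: agreeL_back. Qed.

End LatticeRow.

(** * Lattice solutions and their base diagonals *)

Section Solutions.
Context {dX dXt dU dUt : measure_display}
  {X : measurableType dX} {X' : measurableType dXt}
  {U : measurableType dU} {U' : measurableType dUt}.
Variables (F : X * U -> X' * U') (Finv : X' * U' -> X * U).
Hypotheses (FK : cancel F Finv) (FinvK : cancel Finv F).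
Implicit Types (w : int -> X * U) (y : int -> X * X').
Local Notation row := (row F Finv).
Local Notation diag := (diag F Finv).

Let half (s : int) : int := (s %/ 2)%Z.

Let half_even j s : s = 2 * j -> half s = j.
Proof. by rewrite /half => ->; lia. Qed.

Let half_odd j s : s = 2 * j + 1 -> half s = j.
Proof. by rewrite /half => ->; lia. Qed.

Let evenzP s : evenz s -> exists j, s = 2 * j.
Proof. by rewrite /evenz => h; exists (half s); rewrite /half; lia. Qed.

Let oddzP s : ~~ evenz s -> exists j, s = 2 * j + 1.
Proof. by rewrite /evenz => h; exists (half s); rewrite /half; lia. Qed.

(** The carrier [u_n^t] enters site [(n + 1, t)] and so sits at index [n + 1] of the diagonal with
    sum [n + 1 + t]; hence the extra 1 in [uO_of] and [uE_of]. Off the proper parity the values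
    carry no meaning. *)
Definition xE_of w (n t : int) : X := (diag (half (n + t)) w n).1.
Definition uO_of w (n t : int) : U := (diag (half (n + 1 + t)) w (n + 1)).2.
Definition xO_of w (n t : int) : X' := (step F (diag (half (n + t)) w) n).1.
Definition uE_of w (n t : int) : U' := (step F (diag (half (n + t)) w) (n + 1)).2.

Lemma solII_row w : solII F Finv (row w) (xE_of w) (xO_of w) (uE_of w) (uO_of w).
Proof.
split=> [n t /evenzP[j nt]|n t /oddzP[j nt]|k].
- rewrite /xE_of /uO_of /xO_of /uE_of (half_even nt) subrK (half_even nt).
  rewrite (@half_odd j); last by lia.
  by rewrite -surjective_pairing /step /= addrK -surjective_pairing.
- rewrite /xE_of /uO_of /xO_of /uE_of (half_odd nt) subrK (@half_even j (n - 1 + t)); last by lia.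
  rewrite !(@half_even (j + 1)); [|by lia..].
  rewrite diagS// /next2; set v := step F _.
  by rewrite -surjective_pairing /step /= addrK -surjective_pairing.
- rewrite /xE_of /xO_of (@half_even k); last by lia.
  by rewrite (@half_odd k)//; lia.
Qed.

Definition base_diagonal (xE : int -> int -> X) (uO : int -> int -> U) : int -> X * U :=
  fun k => (xE k (- k), uO (k - 1) (- k)).

Lemma base_diagonal_of w : base_diagonal (xE_of w) (uO_of w) = w.
Proof.
apply/funext => k; rewrite /base_diagonal /xE_of /uO_of subrK addrN.
by rewrite -surjective_pairing.
Qed.

Section FromSolution.
Variables (y : int -> X * X').
Variables (xE : int -> int -> X) (xO : int -> int -> X').
Variables (uE : int -> int -> U') (uO : int -> int -> U).
Hypothesis sol : solII F Finv y xE xO uE uO.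
Let w := base_diagonal xE uO.
Let dE (j k : int) := (xE k (2 * j - k), uO (k - 1) (2 * j - k)).
Let dO (j k : int) := (xO k (2 * j + 1 - k), uE (k - 1) (2 * j + 1 - k)).

Let step_dE j : step F (dE j) = dO j.
Proof.
have [h _ _] := sol; apply/funext => k; rewrite /step /dE /dO.
rewrite h; last by rewrite /evenz; lia.
rewrite h /=; last by rewrite /evenz; lia.
by congr (xO _ _, uE _ _); lia.
Qed.

Let step_dO j : step Finv (dO j) = dE (j + 1).
Proof.
have [_ h _] := sol; apply/funext => k; rewrite /step /dE /dO.
rewrite h; last by rewrite /evenz; lia.
rewrite h /=; last by rewrite /evenz; lia.
by congr (xE _ _, uO _ _); lia.
Qed.

Let diag_dE j : diag j w = dE j.
Proof.
have H i : dE (i + 1) = next2 F Finv (dE i) by rewrite /next2 step_dE step_dO.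
rewrite -(@zpow_uniq _ _ _ (next2K FK FinvK) dE H j); congr zpow.
by apply/funext => k; rewrite /w /dE /base_diagonal; congr (xE _ _, uO _ _); lia.
Qed.

Let step_diag_dO j : step F (diag j w) = dO j.
Proof. by rewrite diag_dE step_dE. Qed.

Lemma sol_row : row w = y.
Proof.
have [_ _ hy] := sol; apply/funext => k; rewrite /row step_diag_dO diag_dE /dE /dO /=.
have [h1 h2] := hy k; rewrite [RHS]surjective_pairing -h1 -h2.
by congr (xE _ _, xO _ _); lia.
Qed.

Lemma sol_xE n t : evenz (n + t) -> xE n t = xE_of w n t.
Proof.
move=> /evenzP[j nt]; rewrite /xE_of (half_even nt) diag_dE /dE /=.
by congr xE; lia.
Qed.

Lemma sol_uE n t : evenz (n + t) -> uE n t = uE_of w n t.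
Proof.
move=> /evenzP[j nt]; rewrite /uE_of (half_even nt) step_diag_dO /dO /=.
by congr uE; lia.
Qed.

Lemma sol_xO n t : ~~ evenz (n + t) -> xO n t = xO_of w n t.
Proof.
move=> /oddzP[j nt]; rewrite /xO_of (half_odd nt) step_diag_dO /dO /=.
by congr xO; lia.
Qed.

Lemma sol_uO n t : ~~ evenz (n + t) -> uO n t = uO_of w n t.
Proof.
move=> /oddzP[j nt]; rewrite /uO_of (@half_even (j + 1)); last by lia.
by rewrite diag_dE /dE /=; congr uO; lia.
Qed.

End FromSolution.

Lemma XstarII_exists y : XstarII F Finv y -> exists w, row w = y.
Proof.
by move=> [[xE [xO [uE [uO sol]]]] _]; exists (base_diagonal xE uO); exact: sol_row sol.
Qed.

Lemma XstarII_unique w w' : XstarII F Finv (row w) -> row w = row w' -> w = w'.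
Proof.
move=> [_ uni] ww'; have sol' := solII_row w'; rewrite -ww' in sol'.
have {}uni := uni _ _ _ _ _ _ _ _ (solII_row w) sol'.
rewrite -[LHS]base_diagonal_of -[RHS]base_diagonal_of; apply/funext => k.
have e1 : evenz (k + - k) by rewrite /evenz; lia.
have o1 : ~~ evenz (k - 1 + - k) by rewrite /evenz; lia.
have [/(_ e1)[h1 _] _] := uni k (- k).
have [_ /(_ o1)[_ h2]] := uni (k - 1) (- k).
by rewrite /base_diagonal h1 h2.
Qed.

(* [T] moves the origin to the site (1, 1): [next2] reaches the diagonal
   [n + t = 2], whose entries are then reindexed by one. *)
Definition advance w : int -> X * U := shift 1 (next2 F Finv w).

(** Restates the event through a single diagonal, on which all maps are measurable; the two carrier
    lemmas below serve the same purpose. *)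
Lemma T_preIIE A y : T_preII F Finv A y <->
  XstarII F Finv y /\ exists w, row w = y /\ A (row (advance w)).
Proof.
have E w : row (advance w) = (fun k => (xE_of w (2 * k + 1) 1, xO_of w (2 * k + 2) 1)).
  apply/funext => k; rewrite /row /advance diag_shift// step_shift -diagSr//.
  rewrite /xE_of /xO_of /shift (@half_even (k + 1) (2 * k + 1 + 1)); last by lia.
  rewrite (@half_odd (k + 1) (2 * k + 2 + 1)); last by lia.
  by congr (_, _); congr fst; congr (_ _); lia.
split=> -[Xy h]; split => //.
  have [xE [xO [uE [uO [sol hA]]]]] := h.
  exists (base_diagonal xE uO); rewrite (sol_row sol); split => //.
  rewrite E; congr (A _): hA; apply/funext => k.
  by rewrite (sol_xE sol) ?(sol_xO sol)// /evenz; lia.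
have [w [<- hA]] := h; exists (xE_of w), (xO_of w), (uE_of w), (uO_of w).
by split; [exact: solII_row|rewrite -E].
Qed.

Lemma U_odd_preIIE n C y : U_odd_preII F Finv n C y <->
  XstarII F Finv y /\ exists w, row w = y /\ C (diag n w (2 * n)).2.
Proof.
have E w : uO_of w (2 * n - 1) 0 = (diag n w (2 * n)).2.
  by rewrite /uO_of subrK (@half_even n)//; lia.
split=> -[Xy h]; split => //.
  have [xE [xO [uE [uO [sol hA]]]]] := h.
  exists (base_diagonal xE uO); rewrite (sol_row sol); split => //.
  by rewrite -E -(sol_uO sol)// /evenz; lia.
have [w [<- hA]] := h; exists (xE_of w), (xO_of w), (uE_of w), (uO_of w).
by split; [exact: solII_row|rewrite E].
Qed.

Lemma U_even_preIIE n C y : U_even_preII F Finv n C y <->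
  XstarII F Finv y /\ exists w, row w = y /\ C (step F (diag n w) (2 * n + 1)).2.
Proof.
have E w : uE_of w (2 * n) 0 = (step F (diag n w) (2 * n + 1)).2.
  by rewrite /uE_of (@half_even n)//; lia.
split=> -[Xy h]; split => //.
  have [xE [xO [uE [uO [sol hA]]]]] := h.
  exists (base_diagonal xE uO); rewrite (sol_row sol); split => //.
  by rewrite -E -(sol_uE sol)// /evenz; lia.
have [w [<- hA]] := h; exists (xE_of w), (xO_of w), (uE_of w), (uO_of w).
by split; [exact: solII_row|rewrite E].
Qed.

End Solutions.

(** * Laws of diagonals *)

Section RectangleIid.
Local Open Scope ereal_scope.
Context {R : realType} {d1 d2 : measure_display}
  {A : measurableType d1} {B : measurableType d2}.
Variables (mA : probability A R) (mB : probability B R).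

(** Rectangular sides generate the product sigma-algebra, so [P] coincides with a product law
    already known to exist and inherits its values on all boxes. *)
Lemma iid_of_rectangles (P : probability (config (A * B)%type) R) :
  (forall K (C : int -> set A) (D : int -> set B),
    (forall n, measurable (C n)) -> (forall n, measurable (D n)) ->
    P [set x | forall n, n \in window K -> C n (x n).1 /\ D n (x n).2] =
    \big[*%E/1%E]_(n <- window K) (mA (C n) * mB (D n))) ->
  is_iid_product P (mA \x mB).
Proof.
move=> hP; have [Q iidQ] := iid_product_exists (product_law mA mB).
pose G : set (set (A * B)) := [set C `*` D | C in measurable & D in measurable].
suff PQ : forall E, measurable E -> P E = Q E.
  by move=> s E us mE; rewrite PQ; [exact: iidQ|exact: measurable_box].
apply: (@config_law_unique _ _ _ G).
- by rewrite measurable_prod_measurableType.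
- move=> _ _ [C mC [D mD <-]] [C' mC' [D' mD' <-]]; rewrite -setXI.
  by exists (C `&` C'); [exact: measurableI|exists (D `&` D') => //; exact: measurableI].
- by exists setT => //; exists setT => //; rewrite setXTT.
move=> K E GE; have /choice[CD hCD] : forall n, exists CD : set A * set B,
    [/\ measurable CD.1, measurable CD.2 & CD.1 `*` CD.2 = E n].
  by move=> n; have [C mC [D mD CDE]] := GE n; exists (C, D).
rewrite iidQ ?uniq_window//; last first.
  by move=> n; have [? ? <-] := hCD n; exact: measurableX.
transitivity (\big[*%E/1%E]_(n <- window K) (mA (CD n).1 * mB (CD n).2)).
  rewrite -hP; [|by move=> n; case: (hCD n)..].
  by congr (P _); apply/seteqP; split => x h n nK; have [_ _ e] := hCD n;
    have := h n nK; rewrite -e.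
by apply: eq_bigr => n _; have [? ? <-] := hCD n; rewrite [RHS]product_lawX.
Qed.

End RectangleIid.

Section MeasurableDiagonals.

Lemma measurable_step d1 d2 d3 d4 (A : measurableType d1) (B : measurableType d2)
    (A' : measurableType d3) (B' : measurableType d4) (F : A * B -> A' * B') :
  measurable_fun setT F ->
  measurable_fun setT (step F : config (A * B)%type -> config (A' * B')%type).
Proof.
move=> mF; apply: measurable_to_config => n; rewrite /step.
apply: measurable_fun_pair.
  exact (measurableT_comp measurable_fst (measurableT_comp mF (measurable_coord n))).
exact (measurableT_comp measurable_snd (measurableT_comp mF (measurable_coord (n - 1)))).
Qed.

Lemma measurable_back d1 d2 d3 d4 (A : measurableType d1) (B : measurableType d2)
    (A' : measurableType d3) (B' : measurableType d4) (F : A' * B' -> A * B) :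
  measurable_fun setT F ->
  measurable_fun setT (back F : config (A' * B')%type -> config (A * B)%type).
Proof.
move=> mF; apply: measurable_to_config => n; rewrite /back.
apply: (measurableT_comp mF); apply: measurable_fun_pair.
  exact (measurableT_comp measurable_fst (measurable_coord n)).
exact (measurableT_comp measurable_snd (measurable_coord (n + 1))).
Qed.

Lemma measurable_shift d (Z : measurableType d) a :
  measurable_fun setT (shift a : config Z -> config Z).
Proof. by apply: measurable_to_config => n; exact: measurable_coord. Qed.

Lemma measurable_iter d (Z : measurableType d) (G : Z -> Z) n :
  measurable_fun setT G -> measurable_fun setT (iter n G).
Proof.
move=> mG; elim: n => [|n ih]; first exact: measurable_id.
exact (measurableT_comp mG ih).
Qed.

Lemma measurable_zpow d (Z : measurableType d) (G Gi : Z -> Z) j :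
  measurable_fun setT G -> measurable_fun setT Gi -> measurable_fun setT (zpow G Gi j).
Proof. by move=> mG mGi; case: j => n; exact: measurable_iter. Qed.

Context {R : realType}.

Definition preserves d (Z : measurableType d) (P : probability Z R) (G : Z -> Z) :=
  forall A, measurable A -> P (G @^-1` A) = P A.

Lemma preserves_iter d (Z : measurableType d) (P : probability Z R) (G : Z -> Z) n :
  measurable_fun setT G -> preserves P G -> preserves P (iter n G).
Proof.
move=> mG PG; elim: n => [//|n ih] A mA.
rewrite -[RHS]PG// -[RHS]ih//; exact: measurable_preimT.
Qed.

Lemma preserves_zpow d (Z : measurableType d) (P : probability Z R) (G Gi : Z -> Z) j :
  measurable_fun setT G -> measurable_fun setT Gi -> cancel G Gi ->
  preserves P G -> preserves P (zpow G Gi j).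
Proof.
move=> mG mGi GK PG; case: j => n; apply: preserves_iter => // A mA.
rewrite -PG; last exact: measurable_preimT.
by congr (P _); apply/seteqP; split => x /=; rewrite GK.
Qed.

Lemma preserves_comp d (Z : measurableType d) (P : probability Z R) (G H : Z -> Z) :
  measurable_fun setT G -> preserves P G -> preserves P H -> preserves P (G \o H).
Proof.
move=> mG PG PH A mA; rewrite -[RHS]PG// -[RHS]PH//; exact: measurable_preimT.
Qed.

Lemma shift_preserves d (Z : measurableType d) (m : set Z -> \bar R)
    (P : probability (config Z) R) a :
  is_iid_product P m -> preserves P (shift a).
Proof.
move=> iidP A mA; rewrite -(image_lawE P (measurable_shift a)).
by apply: (iid_unique (m := m)) => //; exact: shift_iid.
Qed.

End MeasurableDiagonals.

Section StepLaw.
Local Open Scope ereal_scope.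
Context {R : realType} {d1 d2 d3 d4 : measure_display}
  {A : measurableType d1} {B : measurableType d2}
  {A' : measurableType d3} {B' : measurableType d4}.
Variables (mA : probability A R) (mB : probability B R).
Variables (mA' : probability A' R) (mB' : probability B' R).
Variables (F : A * B -> A' * B').
Hypotheses (mF : measurable_fun setT F)
  (detailed_balance : forall E, measurable E -> (mA \x mB) (F @^-1` E) = (mA' \x mB') E).

(** [F] turns each independent pair into an independent pair, so all outputs are independent; [step]
    merely recombines outputs of neighbouring sites. *)
Lemma step_iid (P : probability (config (A * B)%type) R) :
  is_iid_product P (mA \x mB) ->
  is_iid_product (image_law P (measurable_step mF)) (mA' \x mB').
Proof.
move=> iidP; apply: iid_of_rectangles => K C D mC mD; rewrite image_lawE.
(* Output carriers land one index to the right, so the condition at [n + 1] constrains site [n], and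
   the window grows to include the site on its left. *)
pose C' n := if n \in window K then C n else setT.
pose D' n := if (n + 1)%R \in window K then D (n + 1)%R else setT.
have mC' n : measurable (C' n) by rewrite /C'; case: ifP.
have mD' n : measurable (D' n) by rewrite /D'; case: ifP.
rewrite (_ : _ @^-1` _ =
    [set w | forall n, n \in window K.+1 -> (F @^-1` (C' n `*` D' n)) (w n)]); last first.
  apply/seteqP; split => w /= h n.
    move=> nK; split; first by rewrite /C'; case: ifP => // /h[].
    by rewrite /D'; case: ifP => // /h[_]; rewrite /step /= addrK.
  move=> nK; rewrite /step /=.
  have [|+ _] := h n; first by move: nK; rewrite !mem_window; lia.
  have [|_ +] := h (n - 1)%R; first by move: nK; rewrite !mem_window; lia.
  by rewrite /C' /D' nK subrK nK.
rewrite (iidP _ (fun n => F @^-1` (C' n `*` D' n))) ?uniq_window//; last first.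
  by move=> n; apply: measurable_preimT => //; exact: measurableX.
rewrite (eq_bigr (fun n => mA' (C' n) * mB' (D' n))); last first.
  move=> n _; rewrite [LHS]detailed_balance; last exact: measurableX.
  exact: (product_lawX mA' mB').
rewrite !big_split /=; congr (_ * _).
  rewrite /C' (bigID (fun n => n \in window K))/= [X in _ * X]big1 ?mule1; last first.
    by move=> n /negbTE ->; exact: probability_setT.
  rewrite -big_filter (perm_big (window K)).
    by rewrite big_seq [RHS]big_seq; apply: eq_bigr => n ->.
  apply: uniq_perm; rewrite ?filter_uniq ?uniq_window// => n.
  by rewrite mem_filter !mem_window; lia.
rewrite /D' (bigID (fun n => (n + 1)%R \in window K))/= [X in _ * X]big1 ?mule1; last first.
  by move=> n /negbTE ->; exact: probability_setT.
rewrite -big_filter (perm_big [seq (n - 1)%R | n <- window K]).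
  by rewrite big_map big_seq [RHS]big_seq; apply: eq_bigr => n; rewrite subrK => ->.
apply: uniq_perm.
- by rewrite filter_uniq ?uniq_window.
- by rewrite map_inj_uniq ?uniq_window// => i j; lia.
move=> n; rewrite mem_filter; apply/andP/mapP => [[h1 _]|[k kK ->]].
  by exists (n + 1)%R => //; rewrite addrK.
by rewrite subrK; split => //; move: kK; rewrite !mem_window; lia.
Qed.

End StepLaw.

(** * Gluing solutions, and the law of a row *)

Section HasLaw.
Local Open Scope ereal_scope.
Context {R : realType} {d : measure_display} {T : measurableType d}.
Variable P : probability T R.

Lemma full_of_negligible (S : set T) : P.-negligible (~` S) ->
  exists N, [/\ measurable N, P N = 1 & N `<=` S].
Proof.
move=> [Z [mZ PZ SZ]]; exists (~` Z); split; first exact: measurableC.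
  by rewrite probability_setC// PZ sube0.
by move=> x nZ; apply: contrapT => nS; apply: nZ; exact: SZ.
Qed.

Lemma negligible_of_full (N : set T) : measurable N -> P N = 1 -> P.-negligible (~` N).
Proof.
move=> mN PN; exists (~` N); split => //; first exact: measurableC.
by rewrite probability_setC// PN subee.
Qed.

Lemma ae_measurable_has_law (S E N : set T) :
  measurable E -> measurable N -> P N = 1 ->
  (forall x, N x -> S x <-> E x) -> has_law P S (P E).
Proof.
move=> mE mN PN SE; exists E => //; split => //.
apply: negligibleS (negligible_of_full mN PN) => x [[Sx Ex]|[Ex Sx]] Nx.
  by apply: Ex; apply/SE.
by apply: Sx; apply/SE.
Qed.

Lemma has_law_ae_eq (S E N : set T) q : has_law P S q ->
  measurable E -> measurable N -> P N = 1 ->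
  (forall x, N x -> S x <-> E x) -> P E = q.
Proof.
move=> [B mB [negB <-]] mE mN PN SE.
have neg : P.-negligible (~` (N `&` ~` ((S `\` B) `|` (B `\` S)))).
  by rewrite setCI setCK; apply: negligibleU => //; exact: negligible_of_full.
have [M [mM PM MS]] := full_of_negligible neg.
rewrite -(full_measureI mE mM PM) -(full_measureI mB mM PM).
congr (P _); apply/seteqP; split => x [h Mx]; split => //;
  have [Nx SB] := MS x Mx; apply: contrapT => h'; apply: SB.
  by left; split => //; apply/SE.
by right; split => //; apply: contra_not h' => Sx; apply/SE.
Qed.

Lemma has_law1 (S : set T) : has_law P S 1 -> P.-negligible (~` S).
Proof.
move=> [B mB [negB PB]].
apply: negligibleS (negligibleU (negligible_of_full mB PB) negB) => x Sx.
by case: (pselect (B x)) => Bx; [right; right|left].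
Qed.

End HasLaw.

Section Gluing.
Context {X X' U U' : Type}.
Variables (F : X * U -> X' * U') (Finv : X' * U' -> X * U).
Hypotheses (FK : cancel F Finv) (FinvK : cancel Finv F).
Local Notation row := (row F Finv).

Let full_step (A B A' B' : Type) (H : A * B -> A' * B') n w w' :
  (forall k, n < k -> w k = w' k) -> agreeR (n + 1) (step H w) (step H w').
Proof. by move=> h; split=> k hk; rewrite /step /= h//; lia. Qed.

(* Changing the row at site [0] does not affect the carrier arriving there:
   glue the left half of one solution to the right half of the other. *)
Lemma incoming_carrier_causal w w' :
  (forall v, row v = row w' -> v = w') ->
  (forall k, k < 0 -> row w k = row w' k) -> (w 0).2 = (w' 0).2.
Proof.
move=> uni ww'.
(* The glued diagonal follows [w] up to the carrier entering site 0 and [w'] from the variable at 0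
   on; its row is that of [w']. *)
pose v k := if k < 0 then w k else if k == 0 then ((w' 0).1, (w 0).2) else w' k.
have -> // : (w 0).2 = (v 0).2 by [].
rewrite (uni v)//; apply/funext => k; have [k0|k0] := ltP k 0.
  rewrite -ww'//; apply: row_agreeL => //; split => i i0; rewrite /v; first by rewrite i0.
  by case: ltP => // i0'; have -> : i = 0 by lia.
apply: row_agreeR => //; split => i i0; rewrite /v.
  by rewrite ltNge i0 /=; case: eqP => // ->.
by rewrite ltNge ltW//= gt_eqF.
Qed.

(* The time-reversed statement, at the site to the left of [0]. *)
Lemma outgoing_carrier_causal w w' :
  (forall v, row v = row w' -> v = w') ->
  (forall k, 0 <= k -> row w k = row w' k) -> (back F w 0).2 = (back F w' 0).2.
Proof.
move=> uni ww'.
(* Here the cut is made on the diagonal [n + t = -1], between the whole entries -1 and 0. *)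
pose v k := if k < 0 then back F w' k else back F w k.
have -> // : back F w 0 = v 0 by [].
have bv : back F (step Finv v) = v by exact: (stepK FinvK).
rewrite -bv (uni (step Finv v))//; apply/funext => k; have [k0|k0] := ltP k 0.
  by apply: row_agreeL_back => // i i0; rewrite bv /v i0.
rewrite -ww'//; apply: row_agreeR => //.
have h : agreeR (-1 + 1) (step Finv v) (step Finv (back F w)).
  by apply: full_step => i i0; rewrite /v; case: ltP => //; lia.
by rewrite (backK FK) in h.
Qed.

Lemma next2_full w w' : (forall k, 0 < k -> w k = w' k) ->
  agreeR 2 (next2 F Finv w) (next2 F Finv w').
Proof. by move=> h; apply: (@agreeR_step _ _ _ _ _ 1); exact: (@full_step _ _ _ _ _ 0). Qed.

Lemma step_full (A B A' B' : Type) (H : A * B -> A' * B') v v' : (forall k, 1 < k -> v k = v' k) ->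
  agreeR 2 (step H v) (step H v').
Proof. exact: (@full_step _ _ _ _ _ 1). Qed.

Lemma agreeR_shift2 (A B : Type) (w w' : int -> A * B) :
  agreeR 2 w w' -> agreeR 0 (shift 2 w) (shift 2 w').
Proof. by move=> [h1 h2]; split=> k k0; rewrite /shift ?h1 ?h2//; lia. Qed.

End Gluing.

(** * Rows over independent diagonal variables *)

Section RowLaw.
Local Open Scope ereal_scope.
Context {R : realType} {dX dXt dU dUt : measure_display}
  {X : measurableType dX} {X' : measurableType dXt}
  {U : measurableType dU} {U' : measurableType dUt}.
Variables (F : X * U -> X' * U') (Finv : X' * U' -> X * U).
Hypotheses (mF : measurable_fun setT F) (mFinv : measurable_fun setT Finv).
Hypotheses (FK : cancel F Finv) (FinvK : cancel Finv F).
Local Notation W := (config (X * U)%type).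
Local Notation row := (row F Finv).
Local Notation next2 := (next2 F Finv : W -> W).
Local Notation prev2 := (prev2 F Finv : W -> W).
Local Notation diag := (diag F Finv).

Lemma measurable_next2 : measurable_fun setT next2.
Proof. exact (measurableT_comp (measurable_step mFinv) (measurable_step mF)). Qed.

Lemma measurable_prev2 : measurable_fun setT prev2.
Proof. exact (measurableT_comp (measurable_back mFinv) (measurable_back mF)). Qed.

Lemma measurable_diag j : measurable_fun setT (diag j : W -> W).
Proof. exact: measurable_zpow measurable_next2 measurable_prev2. Qed.

Lemma measurable_advance : measurable_fun setT (advance F Finv : W -> W).
Proof. exact (measurableT_comp (measurable_shift 1%R) measurable_next2). Qed.

Lemma measurable_row : measurable_fun setT (row : W -> config (X * X')%type).
Proof.
apply: measurable_to_config => k; apply: measurable_fun_pair.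
  exact (measurableT_comp measurable_fst
    (measurableT_comp (measurable_coord (2 * k)%R) (measurable_diag k))).
exact (measurableT_comp measurable_fst (measurableT_comp (measurable_coord (2 * k + 1)%R)
    (measurableT_comp (measurable_step mF) (measurable_diag k)))).
Qed.

Variables (mu : probability X R) (mut : probability X' R).
Variables (nu : probability U R) (nut : probability U' R).
Hypothesis balance :
  forall E, measurable E -> (mu \x nu) (F @^-1` E) = (mut \x nut) E.

Lemma balance_inv E : measurable E -> (mut \x nut) (Finv @^-1` E) = (mu \x nu) E.
Proof.
move=> mE; rewrite -balance; last exact: measurable_preimT.
by congr ((mu \x nu) _); apply/seteqP; split => x /=; rewrite FK.
Qed.

Variable Q : probability W R.
Hypothesis iidQ : is_iid_product Q (mu \x nu).

Lemma next2_preserves : preserves Q next2.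
Proof.
move=> E mE.
have h1 := step_iid mF balance iidQ.
have h2 := step_iid mFinv balance_inv h1.
by rewrite -(iid_unique h2 iidQ mE).
Qed.

Lemma diag_preserves j : preserves Q (diag j).
Proof.
exact: (preserves_zpow j measurable_next2 measurable_prev2 (next2K FK FinvK) next2_preserves).
Qed.

Lemma advance_preserves : preserves Q (advance F Finv).
Proof.
exact: (preserves_comp (measurable_shift 1%R) (shift_preserves 1%R iidQ) next2_preserves).
Qed.

(** Translates the row by one pair and preserves [Q], so that any window of the row can be moved to
    start at 0. *)
Let rho : W -> W := shift 2%R \o next2.

Let measurable_rho : measurable_fun setT rho.
Proof. exact (measurableT_comp (measurable_shift 2%R) measurable_next2). Qed.

Let rho_preserves : preserves Q rho.
Proof.
exact: (preserves_comp (measurable_shift 2%R) (shift_preserves 2%R iidQ) next2_preserves).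
Qed.

Let row_rho n w k : row (iter n rho w) k = row w (k + n%:Z)%R.
Proof.
elim: n k => [|n ih] k; first by rewrite addr0.
by rewrite iterS /rho /= row_shift2// ih; congr (row w); lia.
Qed.

Let half_row (C : nat -> set X) (D : nat -> set X') J :=
  [set w : W | forall j, (j < J)%N -> C j (row w j%:Z).1 /\ D j (row w j%:Z).2].

Let measurable_half_row C D J : (forall n, measurable (C n)) -> (forall n, measurable (D n)) ->
  measurable (half_row C D J).
Proof.
move=> mC mD; elim: J => [|J ih].
  by rewrite (_ : half_row _ _ _ = setT)//; apply/seteqP; split.
rewrite (_ : half_row _ _ _ =
    half_row C D J `&` (row @^-1` [set y | (C J `*` D J) (y J%:Z)])).
  apply: measurableI => //; apply: (measurable_preimT measurable_row).
  exact (measurable_preimT (measurable_coord J%:Z) (measurableX (mC J) (mD J))).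
apply/seteqP; split => w /=.
  by move=> h; split => [j jJ|]; apply: h; lia.
move=> [h hJ] j; rewrite ltnS leq_eqVlt => /orP[/eqP -> //|]; exact: h.
Qed.

Let half_row_agree C D J w w' : agreeR 0%R w w' -> half_row C D J w -> half_row C D J w'.
Proof. by move=> /(row_agreeR FK FinvK) ww' h j /h; rewrite ww'. Qed.

(** The row is peeled from the left. [x_0] sits in entry 0 of the base diagonal, while the later row
    depends on entries of positive index; on the next diagonal [x_1] sits in entry 1 and the rest
    depends on entries of index above 1. What remains is the [rho]-preimage of a shorter half
    row. *)
Let half_row_law C D J : (forall n, measurable (C n)) -> (forall n, measurable (D n)) ->
  Q (half_row C D J) = \prod_(j < J) (mu (C j) * mut (D j)).
Proof.
elim: J C D => [|J ih] C D mC mD.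
  rewrite big_ord0 -(probability_setT Q); congr (Q _).
  by apply/seteqP; split.
pose C' n := C n.+1; pose D' n := D n.+1.
pose H := half_row C' D' J.
have mH : measurable H.
  by apply: measurable_half_row => n; [exact: mC|exact: mD].
pose tail' : set (config (X' * U')%type) := [set v | H (shift 2%R (step Finv v))].
have mtail' : measurable tail'.
  exact: (measurable_preimT (measurableT_comp (measurable_shift 2%R) (measurable_step mFinv)) mH).
pose tail := [set w : W | D 0%N (step F w 1%R).1 /\ tail' (step F w)].
have mD0 : measurable [set v : config (X' * U')%type | D 0%N (v 1%R).1].
  exact: (measurable_preimT (measurableT_comp measurable_fst (measurable_coord 1%R)) (mD 0%N)).
have mtail : measurable tail.
  exact: (measurable_preimT (measurable_step mF) (measurableI _ _ mD0 mtail')).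
have -> : half_row C D J.+1 = [set w | (C 0%N `*` setT) (w 0%R)] `&` tail.
  have rowE j w : row (shift 2%R (step Finv (step F w))) j%:Z = row w j.+1%:Z.
    by rewrite -[step Finv _]/(next2 w) row_shift2//; congr (row w); lia.
  apply/seteqP; split => w /=.
    move=> h; have [h1 h2] := h 0%N isT; split; first by [].
    by split; [exact: h2|move=> j jJ; rewrite rowE; exact: h].
  move=> [[C0 _] [D0 h]] [|j] jJ; first by split.
  by have := h j jJ; rewrite rowE.
have iidQ' := step_iid mF balance iidQ.
rewrite (iid_indep (m := product_law mu nu) (N := setT))//; last 3 first.
- exact: probability_setT.
- exact: measurableX.
- move=> x z _ _; rewrite /tail.
  have e k : (0 < k)%R -> x k = upd 0%R z x k by move=> k0; rewrite /upd gt_eqF.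
  have e' k : (0 < k)%R -> upd 0%R z x k = x k by move=> /e.
  have e1 : (step F x 1%R).1 = (step F (upd 0%R z x) 1%R).1 by rewrite /step /= e.
  split=> -[h1 h2]; split.
  - by rewrite -e1.
  - by apply: half_row_agree h2; apply: agreeR_shift2; exact: (next2_full F Finv e).
  - by rewrite e1.
  - by apply: half_row_agree h2; apply: agreeR_shift2; exact: (next2_full F Finv e').
rewrite product_lawX// (probability_setT nu) mule1 big_ord_recl -muleA; congr (_ * _).
have -> : Q tail = image_law Q (measurable_step mF)
    ([set v | (D 0%N `*` setT) (v 1%R)] `&` tail').
  rewrite image_lawE; congr (Q _); apply/seteqP; split => w /=.
    by move=> [].
  by move=> [[]].
rewrite (iid_indep (m := product_law mut nut) (N := setT))//; last 3 first.
- exact: probability_setT.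
- exact: measurableX.
- move=> x z _ _; rewrite /tail' /mkset.
  have e k : (1 < k)%R -> x k = upd 1%R z x k by move=> k0; rewrite /upd gt_eqF.
  have e' k : (1 < k)%R -> upd 1%R z x k = x k by move=> /e.
  split; apply: half_row_agree; apply: agreeR_shift2.
    exact: (step_full Finv e).
  exact: (step_full Finv e').
rewrite product_lawX// (probability_setT nut) mule1; congr (_ * _).
rewrite image_lawE -[LHS]/(Q (rho @^-1` H)) rho_preserves// ih.
- by [].
- by move=> n; exact: mC.
- by move=> n; exact: mD.
Qed.

Lemma row_law_iid : is_iid_product (image_law Q measurable_row) (mu \x mut).
Proof.
apply: iid_of_rectangles => K C D mC mD; rewrite image_lawE.
rewrite -(preserves_iter K measurable_rho rho_preserves); last first.
  apply: (measurable_preimT measurable_row).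
  exact: (measurable_box _ (fun n => measurableX (mC n) (mD n))).
pose C' (j : nat) := C (j%:Z - K%:Z)%R; pose D' (j : nat) := D (j%:Z - K%:Z)%R.
rewrite (_ : _ @^-1` _ = half_row C' D' K.*2); last first.
  apply/seteqP; split => w h.
    move=> j jK; have := h (j%:Z - K%:Z)%R; rewrite row_rho subrK; apply.
    by rewrite mem_window; lia.
  rewrite /preimage /mkset => n; rewrite mem_window row_rho => nK.
  have := h (absz (n + K%:Z)%R); rewrite /C' /D'.
  have -> : (absz (n + K%:Z)%R)%:Z = (n + K%:Z)%R by lia.
  by rewrite addrK; apply; lia.
rewrite half_row_law; last 2 first.
- by move=> n; exact: mC.
- by move=> n; exact: mD.
rewrite /window big_map -(big_mkord xpredT (fun j => mu (C' j) * mut (D' j))).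
by rewrite /index_iota subn0.
Qed.

End RowLaw.

(** * Type II models *)

Section Advance.
Context {X X' U U' : Type}.
Variables (F : X * U -> X' * U') (Finv : X' * U' -> X * U).
Hypotheses (FK : cancel F Finv) (FinvK : cancel Finv F).

Lemma row_pred_out (w : int -> X * U) : (row F Finv w (-1)).2 = (back F w (-1)).1.
Proof.
by rewrite /row -[diag F Finv (-1) w]/(back Finv (back F w)) (backK FinvK).
Qed.

End Advance.

Section TypeIITheorem.
Local Open Scope ereal_scope.
Context {R : realType} {dX dXt dU dUt : measure_display}
  {X : measurableType dX} {X' : measurableType dXt}
  {U : measurableType dU} {U' : measurableType dUt}.
Variables (F : X * U -> X' * U') (Finv : X' * U' -> X * U).
Hypotheses (cX : coded X) (cX' : coded X') (cU : coded U) (cU' : coded U').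
Hypothesis mF : measurable_fun setT F.
Hypotheses (FK : cancel F Finv) (FinvK : cancel Finv F).
Variables (mu : probability X R) (mut : probability X' R).
Variable P : probability (config (X * X')%type) R.
Hypothesis iidP : is_iid_product P (mu \x mut).
Hypothesis starP : P.-negligible (~` XstarII F Finv).
Local Notation W := (config (X * U)%type).
Local Notation row := (row F Finv).
Local Notation advance := (advance F Finv).
Local Notation diag := (diag F Finv).
Local Notation Xstar := (XstarII F Finv).

Let measurable_Finv : measurable_fun setT Finv.
Proof.
have [|||s ms sF] := @measurable_section _ _ _ _ F setT (coded_prod cX cU)
    (coded_prod cX' cU') mF.
- exact: measurableT.
- by move=> t _; exists (Finv t).
- by move=> y y' _ /(can_inj FK).
by rewrite (_ : Finv = s)//; apply/funext => t; rewrite -[t in s t]FinvK sF.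
Qed.

Let mrow := measurable_row mF measurable_Finv.

Let back_advance w : back F (advance w) = shift 1%R (step F w).
Proof.
rewrite -[advance w]/(shift 1%R (step Finv (step F w))) back_shift.
by rewrite (stepK FinvK).
Qed.

Let regular_section : exists N (s : config (X * X')%type -> W),
  [/\ measurable N, P N = 1, N `<=` Xstar, measurable_fun setT s &
      forall w, N (row w) -> s (row w) = w].
Proof.
have [N [mN PN NX]] := full_of_negligible starP; exists N.
have [||s ms sE] := @measurable_section _ _ W (config (X * X')%type) row N
    (coded_config (coded_prod cX cU)) (coded_config (coded_prod cX cX')) mrow mN.
- by move=> t /NX; exact: XstarII_exists.
- by move=> w w' /NX; exact: XstarII_unique.
by exists s.
Qed.

Section Sufficiency.
Variables (nu : probability U R) (nut : probability U' R).
Hypothesis balance :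
  forall E, measurable E -> (mu \x nu) (F @^-1` E) = (mut \x nut) E.

(** Almost surely [s] recovers the diagonal, so the event is the [s]-preimage of [E] up to a null
    set; as [row] carries [Q] to [P], its probability is [Q E]. *)
Let row_functional_law (S : set (config (X * X')%type)) (E : set W) :
  measurable E -> (forall y, S y <-> Xstar y /\ exists w, row w = y /\ E w) ->
  forall Q : probability W R, is_iid_product Q (mu \x nu) -> has_law P S (Q E).
Proof.
move=> mE SE Q iidQ; have [N [s [mN PN NX ms sE]]] := regular_section.
have Prow A : measurable A -> P A = Q (row @^-1` A).
  exact: (iid_unique iidP (row_law_iid mF measurable_Finv FK FinvK balance iidQ)).
have -> : Q E = P (s @^-1` E).
  have mN' := measurable_preimT mrow mN.
  have QN : Q (row @^-1` N) = 1 by rewrite -Prow.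
  have msE := measurable_preimT ms mE.
  rewrite Prow// -(full_measureI mE mN' QN).
  rewrite -[RHS](full_measureI (measurable_preimT mrow msE) mN' QN).
  congr (Q _); apply/seteqP; split => w [h Nw]; split => //.
    by rewrite /preimage /mkset sE.
  by move: h; rewrite /preimage /mkset sE.
apply: (ae_measurable_has_law (measurable_preimT ms mE) mN PN) => y Ny.
have [w wy] := XstarII_exists FK FinvK (NX y Ny); rewrite -wy in Ny *.
rewrite SE /preimage /mkset sE//; split=> [[_ [w' [/esym ww' Ew']]]|Ew].
  by rewrite (XstarII_unique FK FinvK (NX _ Ny) ww').
by split; [exact: NX|exists w].
Qed.

Lemma typeII_invariant A : measurable A -> has_law P (T_preII F Finv A) (P A).
Proof.
move=> mA; have [Q iidQ] := iid_product_exists (product_law mu nu).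
have madv := measurable_advance mF measurable_Finv.
have -> : P A = Q (advance @^-1` (row @^-1` A)).
  rewrite (advance_preserves mF measurable_Finv FK balance iidQ).
    exact: (iid_unique iidP (row_law_iid mF measurable_Finv FK FinvK balance iidQ)).
  exact: (measurable_preimT mrow mA).
apply: row_functional_law => //; last by move=> y; exact: T_preIIE.
exact (measurable_preimT madv (measurable_preimT mrow mA)).
Qed.

Let mdiag j : measurable_fun setT (diag j : W -> W).
Proof. exact: (measurable_diag mF measurable_Finv). Qed.

Lemma typeII_odd_carrier n C : measurable C -> has_law P (U_odd_preII F Finv n C) (nu C).
Proof.
move=> mC; have [Q iidQ] := iid_product_exists (product_law mu nu).
pose E := [set w : W | (setT `*` C) (w (2 * n)%R)].
have mE : measurable E.
  exact (measurable_preimT (measurable_coord _) (measurableX measurableT mC)).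
have -> : nu C = Q (diag n @^-1` E).
  rewrite (diag_preserves mF measurable_Finv FK FinvK balance iidQ)//.
  have := @iidQ [:: (2 * n)%R] (fun=> setT `*` C) isT
    (fun=> measurableX measurableT mC).
  rewrite big_seq1 product_lawX// [mu setT]probability_setT mul1e => <-.
  congr (Q _); apply/seteqP; split => w h; first exact: (h _ (mem_head _ _)).
  by move=> k; rewrite inE => /eqP ->.
apply: row_functional_law => //; first exact (measurable_preimT (mdiag n) mE).
move=> y; rewrite U_odd_preIIE//; split=> -[Xy [w [wy h]]]; split => //; exists w; split => //.
by case: h.
Qed.

(** The carrier leaving site [2 * n] is the second output of [F] there, and [balance] gives its
    law. *)
Lemma typeII_even_carrier n C : measurable C -> has_law P (U_even_preII F Finv n C) (nut C).
Proof.
move=> mC; have [Q iidQ] := iid_product_exists (product_law mu nu).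
have mFC : measurable (F @^-1` (setT `*` C)).
  exact: measurable_preimT mF (measurableX measurableT mC).
pose E := [set w : W | (F @^-1` (setT `*` C)) (w (2 * n)%R)].
have mE : measurable E by exact (measurable_preimT (measurable_coord _) mFC).
have -> : nut C = Q (diag n @^-1` E).
  rewrite (diag_preserves mF measurable_Finv FK FinvK balance iidQ)//.
  have := @iidQ [:: (2 * n)%R] (fun=> F @^-1` (setT `*` C)) isT (fun=> mFC).
  rewrite big_seq1 [X in _ = X -> _]balance; last exact: measurableX.
  rewrite -[(mut \x nut) _]/(product_law mut nut _) product_lawX//.
  rewrite [mut setT]probability_setT mul1e => <-.
  congr (Q _); apply/seteqP; split => w h; first exact: (h _ (mem_head _ _)).
  by move=> k; rewrite inE => /eqP ->.
have UE w : (step F (diag n w) (2 * n + 1)%R).2 = (F (diag n w (2 * n)%R)).2.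
  by rewrite /step addrK.
apply: row_functional_law => //; first exact (measurable_preimT (mdiag n) mE).
move=> y; rewrite U_even_preIIE//; split=> -[Xy [w [wy h]]]; split => //; exists w; split => //.
  by split => //; rewrite -UE.
by rewrite UE; case: h.
Qed.

End Sufficiency.

Lemma typeII_balance :
  (forall A, measurable A -> has_law P (T_preII F Finv A) (P A)) ->
  exists (nu : probability U R) (nut : probability U' R),
    forall B, measurable B -> (mu \x nu) (F @^-1` B) = (mut \x nut) B.
Proof.
move=> inv; have [N [s [mN PN NX ms sE]]] := regular_section.
have rowK y : N y -> row (s y) = y.
  by move=> Ny; have [w wy] := XstarII_exists FK FinvK (NX _ Ny); rewrite -wy in Ny *; rewrite sE.
have uniN y v : N y -> row v = row (s y) -> v = s y.
  move=> Ny e; apply/esym; apply: (XstarII_unique FK FinvK) => //.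
  by rewrite rowK//; exact: NX.
(* [Uin] is the carrier entering site [(0, 0)]; [Uout] is the one leaving site [(-1, -1)], whose
   other output is the row variable [x_{-1}]. *)
pose Uin y := (s y 0%R).2; pose Uout y := (back F (s y) 0%R).2.
have mUin : measurable_fun setT Uin.
  exact (measurableT_comp measurable_snd (measurableT_comp (measurable_coord 0%R) ms)).
have mUout : measurable_fun setT Uout.
  exact (measurableT_comp measurable_snd (measurableT_comp (measurable_coord 0%R)
    (measurableT_comp (measurable_back mF) ms))).
pose nu := image_law P mUin; pose nut := image_law P mUout.
have indep_in A B : measurable A -> measurable B ->
    P ([set y | (A `*` setT) (y 0%R)] `&` Uin @^-1` B) = mu A * nu B.
  move=> mA mB; rewrite (iid_indep (m := product_law mu mut) (N := N))//.
  - by rewrite product_lawX// [mut setT]probability_setT mule1.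
  - exact: measurable_preimT.
  - exact: measurableX.
  - move=> y z Ny Ny'; rewrite /preimage /mkset.
    suff -> : Uin y = Uin (upd 0%R z y) by [].
    apply: (incoming_carrier_causal FK FinvK) => [v|k k0]; first exact: uniN.
    by rewrite !rowK// /upd lt_eqF.
have indep_out A B : measurable A -> measurable B ->
    P ([set y | (setT `*` A) (y (-1)%R)] `&` Uout @^-1` B) = mut A * nut B.
  move=> mA mB; rewrite (iid_indep (m := product_law mu mut) (N := N))//.
  - by rewrite product_lawX// [mu setT]probability_setT mul1e.
  - exact: measurable_preimT.
  - exact: measurableX.
  - move=> y z Ny Ny'; rewrite /preimage /mkset.
    suff -> : Uout y = Uout (upd (-1)%R z y) by [].
    apply: (outgoing_carrier_causal FK FinvK) => [v|k k0]; first exact: uniN.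
    by rewrite !rowK// /upd gt_eqF//; lia.
have ms0 : measurable_fun setT (fun y => s y 0%R).
  exact (measurableT_comp (measurable_coord 0%R) ms).
(* The first component of [s y 0] is known to be [x_0] on [N], hence the restriction to [N] when
   rectangles are compared. *)
have law0 B : measurable B -> product_law mu nu B = P ((fun y => s y 0%R) @^-1` B).
  move=> mB; rewrite -(image_lawE P ms0); apply: product_law_unique => // A C mA mC.
  rewrite image_lawE -indep_in//.
  have mAC := measurable_preimT ms0 (measurableX mA mC).
  rewrite -(full_measureI mAC mN PN) -[RHS](full_measureI _ mN PN); last first.
    apply: measurableI; last exact: measurable_preimT.
    exact (measurable_preimT (measurable_coord 0%R) (measurableX mA measurableT)).
  have s0 y : N y -> (s y 0%R).1 = (y 0%R).1 by move=> Ny; rewrite -{2}(rowK y Ny).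
  congr (P _); apply/seteqP; split => y [[h1 h2] Ny]; split => //.
    by split; [split => //; rewrite -s0|].
  by case: h1 => h1 _; split => //=; rewrite s0.
exists nu, nut => B mB; apply/esym.
rewrite -[RHS](image_lawE (product_law mu nu) mF) -[LHS]/(product_law mut nut B).
apply: product_law_unique => // {B mB} A B mA mB.
rewrite image_lawE law0; last exact: measurable_preimT mF (measurableX mA mB).
pose D : set (config (X * X')%type) := [set y | (setT `*` A) (y (-1)%R)] `&` Uout @^-1` B.
have -> : mut A * nut B = P D by rewrite -indep_out.
have mD : measurable D.
  apply: measurableI; last exact: measurable_preimT.
  exact (measurable_preimT (measurable_coord (-1)%R) (measurableX measurableT mA)).
(* Invariance is applied to [N] itself: the dynamics maps almost every configuration into [N], where
   [s] can be used again. *)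
have [M [mM PM MT]] : exists M, [/\ measurable M, P M = 1 & M `<=` T_preII F Finv N].
  by apply: full_of_negligible; apply: has_law1; rewrite -PN; exact: inv.
have PNM : P (N `&` M) = 1 by rewrite full_measureI.
apply: (has_law_ae_eq (inv D mD) _ (measurableI _ _ mN mM) PNM).
  exact: measurable_preimT (ms0) (measurable_preimT mF (measurableX mA mB)).
move=> y [Ny /MT]; rewrite !T_preIIE// => -[Xy [w [wy Nadv]]].
have {}wy : w = s y by apply: uniN => //; rewrite wy rowK.
rewrite wy in Nadv => {wy w}.
(* Once the origin has moved to [(1, 1)], the former site [(0, 0)] has coordinates [(-1, -1)]; the
   pair with independent components found there consists of the two outputs of [F] at the old
   origin. *)
have DE : D (row (advance (s y))) <-> (A `*` B) (F (s y 0%R)).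
  have e1 : (row (advance (s y)) (-1)%R).2 = (F (s y 0%R)).1.
    by rewrite row_pred_out// back_advance /shift /step addNr.
  have e2 : (back F (advance (s y)) 0%R).2 = (F (s y 0%R)).2.
    by rewrite back_advance /shift /step add0r subrr.
  by rewrite /D /Uout /setX /preimage /setI /mkset sE// e1 e2; split=> [[[_ h1] h2]|[h1 h2]].
split=> [[_ [w [wy]]]|h].
  have -> : w = s y by apply: uniN => //; rewrite wy rowK.
  by move=> /DE.
by split => //; exists (s y); rewrite rowK//; split => //; apply/DE.
Qed.

End TypeIITheorem.

(** * Type I models *)

Section HasLawTransport.
Local Open Scope ereal_scope.
Context {R : realType} {d d' : measure_display}
  {T : measurableType d} {T' : measurableType d'}.
Variables (P : probability T R) (P' : probability T' R) (g : T' -> T).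
Hypothesis mg : measurable_fun setT g.
Hypothesis law_g : forall A, measurable A -> P' (g @^-1` A) = P A.

Lemma negligible_preimage Z : P.-negligible Z -> P'.-negligible (g @^-1` Z).
Proof.
move=> [A [mA PA ZA]]; exists (g @^-1` A); split.
- exact: measurable_preimT.
- by rewrite -PA; exact: law_g.
- by move=> x; exact: ZA.
Qed.

Lemma has_law_preimage (S : set T) (S' Z : set T') q : P'.-negligible Z ->
  (forall x, ~ Z x -> S' x <-> S (g x)) -> has_law P S q -> has_law P' S' q.
Proof.
move=> negZ SS' [B mB [negB PB]]; exists (g @^-1` B); first exact: measurable_preimT.
split; last by rewrite -PB; exact: law_g.
apply: negligibleS (negligibleU negZ (negligible_preimage negB)) => x.
case: (pselect (Z x)) => Zx; first by left.
move=> [[h1 h2]|[h1 h2]]; right.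
  by left; split => //; apply/SS'.
by right; split => // Sg; apply: h2; apply/SS'.
Qed.

End HasLawTransport.

Lemma has_law_unique (R : realType) d (T : measurableType d) (P : probability T R)
  (S : set T) q q' : has_law P S q -> has_law P S q' -> q = q'.
Proof.
move=> [B mB [negB <-]] h'; have := negB; rewrite -[X in _.-negligible X]setCK.
move=> /full_of_negligible[N [mN PN NB]].
apply: (has_law_ae_eq h' mB mN PN) => x /NB SB; split=> h; apply: contrapT => h2; apply: SB.
  by left.
by right.
Qed.

Section Pairing.
Context {d : measure_display} {X : measurableType d}.

(* Since [F_n^t = F] for all [n, t], a type I model is a type II model with
   [Finv = F]; only the encoding of its configurations differs. *)
Definition pair_up (x : config X) : config (X * X)%type :=
  fun k => (x (2 * k), x (2 * k + 1)).

Definition unpair (y : config (X * X)%type) : config X :=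
  fun n => if evenz n then (y (n %/ 2)%Z).1 else (y (n %/ 2)%Z).2.

Lemma pair_upK : cancel pair_up unpair.
Proof.
move=> x; apply/funext => n; rewrite /pair_up /unpair /evenz.
by case: ifP => hn /=; congr x; lia.
Qed.

Lemma unpairK : cancel unpair pair_up.
Proof.
move=> y; apply/funext => k; rewrite /pair_up /unpair.
have -> : evenz (2 * k) by rewrite /evenz; lia.
have -> : evenz (2 * k + 1) = false by rewrite /evenz; lia.
by rewrite [RHS]surjective_pairing; congr ((y _).1, (y _).2); lia.
Qed.

Lemma measurable_pair_up : measurable_fun setT pair_up.
Proof.
apply: measurable_to_config => k; apply: measurable_fun_pair; exact: measurable_coord.
Qed.

Lemma measurable_unpair : measurable_fun setT unpair.
Proof.
apply: measurable_to_config => n; rewrite /unpair; case: (evenz n).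
  exact (measurableT_comp measurable_fst (measurable_coord _)).
exact (measurableT_comp measurable_snd (measurable_coord _)).
Qed.

Lemma pair_up_iid (R : realType) (m : probability X R) (P : probability (config X) R) :
  is_iid_product P m -> is_iid_product (image_law P measurable_pair_up) (m \x m)%E.
Proof.
move=> iidP; apply: iid_of_rectangles => K C D mC mD; rewrite image_lawE.
pose A n := if evenz n then C (n %/ 2)%Z else D (n %/ 2)%Z.
have mA n : measurable (A n) by rewrite /A; case: ifP.
have A0 k : A (2 * k) = C k.
  rewrite /A (_ : evenz (2 * k)); last by rewrite /evenz; lia.
  by congr C; lia.
have A1 k : A (2 * k + 1) = D k.
  rewrite /A (_ : evenz (2 * k + 1) = false); last by rewrite /evenz; lia.
  by congr D; lia.
pose s := [seq 2 * k | k <- window K] ++ [seq 2 * k + 1 | k <- window K].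
have us : uniq s.
  rewrite cat_uniq; apply/and3P; split.
  - by rewrite map_inj_uniq ?uniq_window// => i j; lia.
  - by apply/hasPn => _ /mapP[i _ ->]; apply/negP => /mapP[j _]; lia.
  - by rewrite map_inj_uniq ?uniq_window// => i j; lia.
have -> : pair_up @^-1` [set y | forall n, n \in window K -> C n (y n).1 /\ D n (y n).2] =
    [set x | forall n, n \in s -> A n (x n)].
  apply/seteqP; split => x h n.
    rewrite mem_cat => /orP[] /mapP[k kK ->]; first by rewrite A0; case: (h k kK).
    by rewrite A1; case: (h k kK).
  move=> nK; rewrite -A0 -A1; split; apply: h; rewrite mem_cat; apply/orP.
    by left; apply/mapP; exists n.
  by right; apply/mapP; exists n.
rewrite iidP// big_cat !big_map big_split /=.
by congr (_ * _)%E; apply: eq_bigr => n _; rewrite ?A0 ?A1.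
Qed.

End Pairing.

(** * Type I solutions as type II solutions *)

Section TypeIReduction.
Context {dX dU : measure_display} {X : measurableType dX} {U : measurableType dU}.
Variable F : X * U -> X * U.
Implicit Types x : config X.

Let merge (A : Type) (e o : int -> int -> A) (n t : int) := if evenz (n + t) then e n t else o n t.

Let solI_merge x xE xO uE uO : solII F F (pair_up x) xE xO uE uO ->
  solI F x (merge xE xO) (merge uE uO).
Proof.
move=> [he ho h0]; split=> [n t|n]; rewrite /merge.
  have -> : evenz (n + (t + 1)) = ~~ evenz (n + t) by rewrite /evenz; lia.
  have -> : evenz (n - 1 + t) = ~~ evenz (n + t) by rewrite /evenz; lia.
  by case: ifP => [/he|/negbT/ho].
rewrite addr0; have [h1 h2] := h0 (n %/ 2)%Z; case: ifP; rewrite /evenz => hn.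
  by move: h1; rewrite /pair_up /= (_ : 2 * _ = n)//; lia.
by move: h2; rewrite /pair_up /= (_ : 2 * _ + 1 = n)//; lia.
Qed.

Let solII_diagonal x xs us : solI F x xs us -> solII F F (pair_up x) xs xs us us.
Proof. by move=> [h h0]; split=> [n t _|n t _|k]; rewrite ?h// !h0. Qed.

Let solII_unique x xs us xE xO uE uO : XstarI F x -> solI F x xs us ->
  solII F F (pair_up x) xE xO uE uO ->
  forall n t, (evenz (n + t) -> xE n t = xs n t /\ uE n t = us n t) /\
    (~~ evenz (n + t) -> xO n t = xs n t /\ uO n t = us n t).
Proof.
move=> [xs0 [us0 [_ uni]]] /uni[-> ->] /solI_merge/uni[<- <-] n t.
by rewrite /merge; split=> [->//|/negbTE->].
Qed.

Lemma XstarI_pair_up x : XstarI F x -> XstarII F F (pair_up x).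
Proof.
move=> Xx; have [xs [us [sol _]]] := Xx; split.
  by exists xs, xs, us, us; exact: solII_diagonal.
move=> xE xO uE uO xE' xO' uE' uO' h h' n t.
have [h1 h2] := solII_unique Xx sol h n t; have [h1' h2'] := solII_unique Xx sol h' n t.
split=> nt.
  by have [-> ->] := h1 nt; have [-> ->] := h1' nt.
by have [-> ->] := h2 nt; have [-> ->] := h2' nt.
Qed.

(** The type II dynamics contains a translation by one site that is absent from the type I dynamics;
    [A'] compensates for it. *)
Lemma T_preI_pair_up (A : set (config X)) A' x :
  (forall z, A z <-> A' (pair_up (shift 1 z))) ->
  XstarI F x -> T_preI F A x <-> T_preII F F A' (pair_up x).
Proof.
move=> AA' Xx; have [xs [us [sol uni]]] := Xx.
have E : (fun k => (xs (2 * k + 1) 1, xs (2 * k + 2) 1)) = pair_up (shift 1 (xs ^~ 1)).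
  by apply/funext => k; rewrite /pair_up /shift -addrA.
split=> -[_].
  move=> [xs' [us' [/uni[-> _] /AA' hA]]]; split; first exact: XstarI_pair_up.
  by exists xs, xs, us, us; split; [exact: solII_diagonal|rewrite E].
move=> [xE [xO [uE [uO [sol' hA]]]]]; split => //; exists xs, us; split => //.
apply/AA'; rewrite -E; congr (A' _): hA; apply/funext => k.
have o1 : evenz (2 * k + 1 + 1) by rewrite /evenz; lia.
have o2 : ~~ evenz (2 * k + 2 + 1) by rewrite /evenz; lia.
have [/(_ o1)[-> _] _] := solII_unique Xx sol sol' (2 * k + 1) 1.
by have [_ /(_ o2)[-> _]] := solII_unique Xx sol sol' (2 * k + 2) 1.
Qed.

Lemma U_preI_even n (C : set U) x : XstarI F x ->
  U_preI F (2 * n) C x <-> U_even_preII F F n C (pair_up x).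
Proof.
move=> Xx; have [xs [us [sol uni]]] := Xx.
split=> -[_].
  move=> [xs' [us' [/uni[_ ->] hC]]]; split; first exact: XstarI_pair_up.
  by exists xs, xs, us, us; split; [exact: solII_diagonal|].
move=> [xE [xO [uE [uO [sol' hC]]]]]; split => //; exists xs, us; split => //.
have e : evenz (2 * n + 0) by rewrite /evenz; lia.
by have [/(_ e)[_ <-] _] := solII_unique Xx sol sol' (2 * n) 0.
Qed.

Lemma U_preI_odd n (C : set U) x : XstarI F x ->
  U_preI F (2 * n - 1) C x <-> U_odd_preII F F n C (pair_up x).
Proof.
move=> Xx; have [xs [us [sol uni]]] := Xx.
split=> -[_].
  move=> [xs' [us' [/uni[_ ->] hC]]]; split; first exact: XstarI_pair_up.
  by exists xs, xs, us, us; split; [exact: solII_diagonal|].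
move=> [xE [xO [uE [uO [sol' hC]]]]]; split => //; exists xs, us; split => //.
have e : ~~ evenz (2 * n - 1 + 0) by rewrite /evenz; lia.
by have [_ /(_ e)[_ <-]] := solII_unique Xx sol sol' (2 * n - 1) 0.
Qed.

Let solI_shift a x xs us : solI F x xs us ->
  solI F (shift a x) (fun n => xs (n + a)) (fun n => us (n + a)).
Proof. by move=> [h h0]; split=> [n t|n]; [rewrite addrAC h|rewrite h0]. Qed.

Lemma XstarI_shift a x : XstarI F x -> XstarI F (shift a x).
Proof.
move=> [xs [us [sol uni]]]; exists (fun n => xs (n + a)), (fun n => us (n + a)).
split=> [|xs' us' /(solI_shift (- a)) sol']; first exact: solI_shift.
have xK : shift (- a) (shift a x) = x by apply/funext => n; rewrite /shift subrK.
rewrite xK in sol'; have [<- <-] := uni _ _ sol'.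
by split; apply/funext => n; rewrite addrK.
Qed.

(** A type I lattice is homogeneous under translation by a single site, which the parity of a type
    II lattice forbids. *)
Lemma U_preI_shift a n (C : set U) x : XstarI F x ->
  U_preI F (n + a) C x <-> U_preI F n C (shift a x).
Proof.
move=> Xx; have Xa := XstarI_shift a Xx; have [xs [us [sol uni]]] := Xx.
have [xa [ua [sola unia]]] := Xa.
have [e1 e2] := unia _ _ (solI_shift a sol).
split=> -[_].
  move=> [xs' [us' [/uni[_ ->] hC]]]; split => //; exists xa, ua.
  by split => //; rewrite -e2.
move=> [xs' [us' [/unia[_ ->] hC]]]; split => //; exists xs, us.
by split => //; move: hC; rewrite -e2.
Qed.

End TypeIReduction.

Section TypeITheorem.
Local Open Scope ereal_scope.
Context {R : realType} {dX dU : measure_display}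
  {X : measurableType dX} {U : measurableType dU}.
Variable F : X * U -> X * U.
Hypotheses (cX : coded X) (cU : coded U).
Hypotheses (mF : measurable_fun setT F) (FF : forall z, F (F z) = z).
Variables (mu : probability X R) (P : probability (config X) R).
Hypotheses (iidP : is_iid_product P mu) (starP : P.-negligible (~` XstarI F)).

Let P2 := image_law P (@measurable_pair_up _ X).

Let iidP2 : is_iid_product P2 (mu \x mu) := pair_up_iid iidP.

Let law_unpair A : measurable A -> P2 (@unpair _ X @^-1` A) = P A.
Proof.
by move=> _; rewrite image_lawE; congr (P _); apply/seteqP; split => x /=; rewrite pair_upK.
Qed.

Let starP2_unpair : P2.-negligible (~` (@unpair _ X @^-1` XstarI F)).
Proof. exact: (negligible_preimage (measurable_unpair) law_unpair starP). Qed.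

Let starP2 : P2.-negligible (~` XstarII F F).
Proof.
apply: negligibleS starP2_unpair => y nXy Xy; apply: nXy.
by rewrite -(unpairK y); exact: XstarI_pair_up.
Qed.

Let pull_back S S' q :
  (forall x, XstarI F x -> S x <-> S' (pair_up x)) -> has_law P2 S' q -> has_law P S q.
Proof.
move=> SS' h; apply: (has_law_preimage (@measurable_pair_up _ X) _ starP _ h) => //.
by move=> x /contrapT; exact: SS'.
Qed.

Let push_forward S S' q :
  (forall x, XstarI F x -> S x <-> S' (pair_up x)) -> has_law P S q -> has_law P2 S' q.
Proof.
move=> SS' h; apply: (has_law_preimage (@measurable_unpair _ X) law_unpair starP2_unpair _ h).
by move=> y /contrapT /SS'; rewrite unpairK => [[h1 h2]]; split.
Qed.

(** Two carrier laws are allowed because the type II result does not tell that they coincide. *)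
Let balanced (nu nut : probability U R) :=
  forall B, measurable B -> (mu \x nu) (F @^-1` B) = (mu \x nut) B.

Let even_carrier nu nut : balanced nu nut -> forall n C, measurable C ->
  has_law P (U_preI F (2 * n)%R C) (nut C).
Proof.
move=> bal n C mC; apply: (pull_back (fun x => @U_preI_even _ _ _ _ F n C x)).
exact: (typeII_even_carrier cX cX cU cU mF FF FF iidP2 starP2 bal).
Qed.

Let odd_carrier nu nut : balanced nu nut -> forall n C, measurable C ->
  has_law P (U_preI F (2 * n - 1)%R C) (nu C).
Proof.
move=> bal n C mC; apply: (pull_back (fun x => @U_preI_odd _ _ _ _ F n C x)).
exact: (typeII_odd_carrier cX cX cU cU mF FF FF iidP2 starP2 bal).
Qed.

(** [U_{-1}] has law [nu] and [U_0] has law [nut]; translation by one site preserves [P] and carries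
    one to the other. *)
Let balanced_eq nu nut : balanced nu nut -> forall C, measurable C -> nu C = nut C.
Proof.
move=> bal C mC; apply: (has_law_unique _ (even_carrier bal 0%R mC)).
apply: (has_law_preimage (measurable_shift 1%R) (shift_preserves 1%R iidP) starP _
  (odd_carrier bal 0%R mC)) => x /contrapT Xx.
exact: (U_preI_shift 1%R (2 * 0 - 1)%R C Xx).
Qed.

Lemma typeI_carrier (nu : probability U R) : balanced nu nu ->
  forall n C, measurable C -> has_law P (U_preI F n C) (nu C).
Proof.
move=> bal n C mC; case: (boolP (evenz n)) => hn.
  have -> : n = (2 * (n %/ 2)%Z)%R by move: hn; rewrite /evenz; lia.
  exact: (even_carrier bal _ mC).
have -> : n = (2 * ((n + 1) %/ 2)%Z - 1)%R by move: hn; rewrite /evenz; lia.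
exact: (odd_carrier bal _ mC).
Qed.

Lemma typeI_invariant (nu : probability U R) : balanced nu nu ->
  forall A, measurable A -> has_law P (T_preI F A) (P A).
Proof.
(* The shift by -1 undoes the translation in the type II dynamics; it preserves [P], so [A'] keeps
   the probability of [A]. *)
move=> bal A mA; pose A' := [set y | A (shift (-1)%R (@unpair _ X y))].
have mA' : measurable A'.
  exact (measurable_preimT (measurableT_comp (measurable_shift (-1)%R) (@measurable_unpair _ X)) mA).
have -> : P A = P2 A'.
  rewrite -(shift_preserves (-1)%R iidP mA); congr (P _).
  by apply/seteqP; split => x; rewrite /A' /preimage /mkset pair_upK.
apply: (@pull_back _ (T_preII F F A')) => [x|].
  apply: T_preI_pair_up => z; rewrite /A' /mkset pair_upK.
  by rewrite (_ : shift (-1) (shift 1 z) = z)//; apply/funext => n; rewrite /shift subrK.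
exact: (typeII_invariant cX cX cU cU mF FF FF iidP2 starP2 bal).
Qed.

Lemma typeI_balance : (forall A, measurable A -> has_law P (T_preI F A) (P A)) ->
  exists nu : probability U R, balanced nu nu.
Proof.
move=> inv.
have [|nu [nut bal]] := typeII_balance cX cX cU cU mF FF FF iidP2 starP2.
  move=> A' mA'; pose A := [set z : config X | A' (pair_up (shift 1%R z))].
  have mA : measurable A.
    exact (measurable_preimT (measurableT_comp (@measurable_pair_up _ X) (measurable_shift 1%R)) mA').
  have -> : P2 A' = P A.
    exact (esym (shift_preserves 1%R iidP (measurable_preimT (@measurable_pair_up _ X) mA'))).
  by apply: push_forward (inv A mA) => x; exact: T_preI_pair_up.
exists nu => B mB; rewrite bal//.
apply: (product_law_unique (P := product_law mu nu)) => // C D mC mD.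
by rewrite product_lawX// (balanced_eq bal).
Qed.

End TypeITheorem.

Theorem theorem1p1 :
  (* (a) Type I model *)
  (forall (R : realType) (dX dU : measure_display)
     (X0 : measurableType dX) (U0 : measurableType dU)
     (F : X0 * U0 -> X0 * U0),
     @polish_borel R _ X0 -> @polish_borel R _ U0 ->
     measurable_fun setT F -> (forall z, F (F z) = z) ->
     forall (mu : probability X0 R) (P : probability (config X0) R),
       is_iid_product P mu ->
       P.-negligible (~` XstarI F) ->
       ((forall A : set (config X0), measurable A ->
            has_law P (T_preI F A) (P A)) <->
        (exists nu : probability U0 R, forall B : set (X0 * U0), measurable B ->
            (mu \x nu)%E (F @^-1` B) = (mu \x nu)%E B))
       /\
       (forall nu : probability U0 R,
          (forall B : set (X0 * U0), measurable B ->
             (mu \x nu)%E (F @^-1` B) = (mu \x nu)%E B) ->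
          forall (n : int) (C : set U0), measurable C ->
            has_law P (U_preI F n C) (nu C)))
  /\
  (* (b) Type II model *)
  (forall (R : realType) (dX dXt dU dUt : measure_display)
     (X0 : measurableType dX) (Xt0 : measurableType dXt)
     (U0 : measurableType dU) (Ut0 : measurableType dUt)
     (F : X0 * U0 -> Xt0 * Ut0) (Finv : Xt0 * Ut0 -> X0 * U0),
     @polish_borel R _ X0 -> @polish_borel R _ Xt0 ->
     @polish_borel R _ U0 -> @polish_borel R _ Ut0 ->
     measurable_fun setT F -> cancel F Finv -> cancel Finv F ->
     forall (mu : probability X0 R) (mut : probability Xt0 R)
            (P : probability (config (X0 * Xt0)%type) R),
       is_iid_product P (mu \x mut)%E ->
       P.-negligible (~` XstarII F Finv) ->
       ((forall A : set (config (X0 * Xt0)%type), measurable A ->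
            has_law P (T_preII F Finv A) (P A)) <->
        (exists (nu : probability U0 R) (nut : probability Ut0 R),
            forall B : set (Xt0 * Ut0), measurable B ->
              (mu \x nu)%E (F @^-1` B) = (mut \x nut)%E B))
       /\
       (forall (nu : probability U0 R) (nut : probability Ut0 R),
          (forall B : set (Xt0 * Ut0), measurable B ->
             (mu \x nu)%E (F @^-1` B) = (mut \x nut)%E B) ->
          forall n : int,
            (forall C : set U0, measurable C ->
               has_law P (U_odd_preII F Finv n C) (nu C)) /\
            (forall C : set Ut0, measurable C ->
               has_law P (U_even_preII F Finv n C) (nut C)))).
Proof.
split=> [R dX dU X0 U0 F bX bU mF FF mu P iidP starP|].
  have cX := polish_coded bX; have cU := polish_coded bU.
  split; last by move=> nu; exact: (typeI_carrier cX cU mF FF iidP starP).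
  split; first exact: (typeI_balance cX cU mF FF iidP starP).
  by move=> [nu]; exact: (typeI_invariant cX cU mF FF iidP starP).
move=> R dX dXt dU dUt X0 Xt0 U0 Ut0 F Finv bX bXt bU bUt mF FK FinvK mu mut P iidP starP.
have cX := polish_coded bX; have cXt := polish_coded bXt.
have cU := polish_coded bU; have cUt := polish_coded bUt.
split; last first.
  move=> nu nut balance n; split=> C mC.
    exact: (typeII_odd_carrier cX cXt cU cUt mF FK FinvK iidP starP balance).
  exact: (typeII_even_carrier cX cXt cU cUt mF FK FinvK iidP starP balance).
split; first exact: (typeII_balance cX cXt cU cUt mF FK FinvK iidP starP).
move=> [nu [nut balance]].
exact: (typeII_invariant cX cXt cU cUt mF FK FinvK iidP starP balance).
Qed.
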